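(* Let $E \subset \mathbb{R}^2$ be compact, let $\varepsilon>0$, and let $\mathcal{I}$ be the set of inaccessible singularities on $\partial E_\varepsilon$. Then for $\mathcal{H}^1$-almost all $x \in \partial E_\varepsilon\setminus\mathcal{I}$ the (signed) curvature $\kappa$ exists and is given by $$\kappa(s_x) = \frac{\frac{d^2}{ds^2} f^{\xi,y}(s_x)}{\left(1+\left(\frac{d}{ds} f^{\xi,y}(s_x)\right)^2\right)^{3/2}},$$ where the coordinates $s_x$ and $f^{\xi,y}(s_x)$ are associated with a local boundary representation $\mathcal{G}(z)$ at some $z\in\partial E_\varepsilon\setminus\mathcal{I}$, such that $x = z + s_x\xi + f^{\xi,y}(s_x)(z-y)/\varepsilon$ for some extremal pair $(\xi,y)\in\mathcal{P}_z^{\mathrm{ext}}(E_\varepsilon)$.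
   Context: $\mathcal{H}^1$ is one-dimensional Hausdorff measure, $B_r(x)$ is the open Euclidean ball and $E_\varepsilon := \overline{\bigcup_{p \in E} B_\varepsilon(p)}$. For $x \in \partial E_\varepsilon$ the set of contributors is $\Pi_E(x) = \{y \in \partial E : \|y-x\| = \varepsilon\}$, and $\mathrm{Unp}_\varepsilon(E) := \{x \in \partial E_\varepsilon : \Pi_E(x) \text{ is a singleton}\}$. A point $x \in \partial E_\varepsilon$ is smooth if there is $r>0$ with $\partial E_\varepsilon \cap B_r(x) \subset \mathrm{Unp}_\varepsilon(E)$; otherwise it is a singularity, and $S(E_\varepsilon)$ denotes the set of singularities. A vector $\xi \in S^1$ is an outward direction at $x$ if there is a sequence $(x_n) \subset \mathbb{R}^2 \setminus E_\varepsilon$ with $x_n \to x$ and $(x_n - x)/\|x_n - x\| \to \xi$; the set of these is $\Xi_x(E_\varepsilon)$. If $\xi \in \Xi_x(E_\varepsilon)$ and $y \in \Pi_E(x)$ satisfy $\langle y - x, \xi\rangle = 0$, then $\xi$ is an extremal outward direction, $y$ an extremal contributor and $(\xi,y)$ an extremal pair at $x$; the sets of these are $\Xi_x^{\mathrm{ext}}(E_\varepsilon)$, $\Pi_E^{\mathrm{ext}}(x)$ and $\mathcal{P}_x^{\mathrm{ext}}(E_\varepsilon)$. The first two have one or two elements; write $\Xi_x^{\mathrm{ext}}(E_\varepsilon) = \{\xi_1,\xi_2\}$, allowing $\xi_1=\xi_2$, and similarly for $\Pi_E^{\mathrm{ext}}$. For $v \in S^1$ let $U_r(x,v) := \{z \in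 B_r(x) : \langle z - x, v\rangle > 0\}$. Inaccessible singularities: say a sequence of singularities $(x_n)$ has asymptotically opposite contributors if $\left\langle \frac{y_n^{(1)}-x_n}{\varepsilon}, \frac{y_n^{(2)}-x_n}{\varepsilon}\right\rangle \to -1$, where $\{y_n^{(1)},y_n^{(2)}\} = \Pi_E^{\mathrm{ext}}(x_n)$ (possibly with equal elements). $\mathcal{I}$ is the set of singularities $x$ that are of type S6 ($\xi_1=\xi_2$ and there is a sequence $(x_n) \subset S(E_\varepsilon)\setminus\{x\}$ with $x_n\to x$ and asymptotically opposite contributors) or of type S7 ($\xi_1=-\xi_2$ and for each $i\in\{1,2\}$ there are $\delta_i>0$ and a sequence in $U_{\delta_i}(x,\xi_i)\cap S(E_\varepsilon)$ converging to $x$ with asymptotically opposite contributors). Local boundary representation: for $z\in\partial E_\varepsilon$ and $(\xi,y)\in\mathcal{P}_z^{\mathrm{ext}}(E_\varepsilon)$ define, for $s\in[0,\varepsilon/2]$, $f^{\xi,y}(s) := \max\{t\in\mathbb{R} : \mathrm{dist}(z+s\xi+t\tfrac{z-y}{\varepsilon}, E^{\xi,y})\le\varepsilon\}$ with $E^{\xi,y} := E\cap\overline{U_{\varepsilon/2}(y,\xi)}$, and $g_{\xi,y}(s) := z+s\xi+f^{\xi,y}(s)\frac{z-y}{\varepsilon}$. The collection $\mathcal{G}(z)=\{g_{\xi,y} : (\xi,y)\in\mathcal{P}_z^{\mathrm{ext}}(E_\varepsilon)\}$ is a local boundary representation of radius $r>0$ at $z$ if $\partial E_\varepsilon\cap\overline{B_r(z)}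 = \bigcup_{(\xi,y)} g_{\xi,y}(A_{\xi,y})$ for some closed sets $A_{\xi,y}\subset[0,\varepsilon/2]$; the coordinate $s_x$ is taken in $A_{\xi,y}$. Existence of curvature at $x$ means that, in such coordinates, the two-sided derivative $\frac{d}{ds}f^{\xi,y}(s_x)$ exists and the second derivative exists at $s_x$ in the sense that the one-sided derivative functions $D^\pm f^{\xi,y}(s) := \lim_{h\to\pm 0}\frac{f^{\xi,y}(s+h)-f^{\xi,y}(s)}{h}$ are both differentiable at $s_x$ with a common value $\frac{d^2}{ds^2}f^{\xi,y}(s_x)$. *)

(* Defs.v *)
(* MathComp-Analysis. *)
From HB Require Import structures.
From mathcomp Require Import all_boot all_order all_algebra.
From mathcomp Require Import all_classical all_reals all_analysis.
Import Order.TTheory GRing.Theory Num.Theory.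
Import numFieldNormedType.Exports.

Set Implicit Arguments.
Unset Strict Implicit.
Unset Printing Implicit Defensive.

Local Open Scope classical_set_scope.
Local Open Scope ring_scope.

(* The canonical norm of ['rV[R]_2] is the sup norm, so the Euclidean norm is
   defined here; the two norms give the same topology, hence [closure],
   [compact] and sequential limits are those of the library. *)
Notation plane R := 'rV[R]_2.

Section Plane.
Variable R : realType.
Implicit Types (u v x y z xi n : plane R) (A E : set (plane R)) (r eps : R).

Definition dot u v : R := \sum_(i < 2) u 0 i * v 0 i.

Definition enorm u : R := Num.sqrt (dot u u).

Definition eball x r : set (plane R) := [set z | enorm (z - x) < r].

(* Only used for nonempty [A] ([inf set0 = 0]). *)
Definition edist x A : R := inf [set enorm (x - q) | q in A].

Definition boundary A : set (plane R) := closure A `\` interior A.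

Definition half_ball r x v : set (plane R) :=
  [set z | eball x r z /\ 0 < dot (z - x) v].

(* The union with [[set 0]] makes the diameter of the empty set 0. *)
Definition ediam A : \bar R :=
  ereal_sup ([set 0%E] `|` [set (enorm (p.1 - p.2))%:E | p in A `*` A]).

Definition hausdorff1_pre (d : R) A : \bar R :=
  ereal_inf [set (\sum_(0 <= k <oo) ediam (U k))%E | U in
    [set U : (set (plane R))^nat |
      A `<=` \bigcup_k U k /\ forall k, (ediam (U k) <= d%:E)%E]].

Definition hausdorff1 A : \bar R :=
  ereal_sup [set hausdorff1_pre d A | d in [set d : R | 0 < d]].

(* The closed [eps]-neighbourhood $E_\varepsilon$. *)
Definition nbhd_eps E eps : set (plane R) :=
  closure (\bigcup_(p in E) eball p eps).

Definition contributors E eps x : set (plane R) :=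
  [set y | boundary E y /\ enorm (y - x) = eps].

Definition Unp E eps : set (plane R) :=
  [set x | boundary (nbhd_eps E eps) x /\
           exists y, contributors E eps x = [set y]].

Definition smooth_point E eps x : Prop :=
  boundary (nbhd_eps E eps) x /\
  exists2 r, 0 < r & boundary (nbhd_eps E eps) `&` eball x r `<=` Unp E eps.

Definition singularities E eps : set (plane R) :=
  [set x | boundary (nbhd_eps E eps) x /\ ~ smooth_point E eps x].

Definition unit_vec v : plane R := (enorm v)^-1 *: v.

Definition outward_directions E eps x : set (plane R) :=
  [set xi | enorm xi = 1 /\
    exists u : (plane R)^nat,
      [/\ forall k, ~ nbhd_eps E eps (u k),
          u @ \oo --> x &
          (fun k => unit_vec (u k - x)) @ \oo --> xi]].

Definition extremal_pairs E eps x : set (plane R * plane R) :=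
  [set p | [/\ outward_directions E eps x p.1,
               contributors E eps x p.2 & dot (p.2 - x) p.1 = 0]].

Definition extremal_directions E eps x : set (plane R) :=
  [set xi | exists y, extremal_pairs E eps x (xi, y)].

Definition extremal_contributors E eps x : set (plane R) :=
  [set y | exists xi, extremal_pairs E eps x (xi, y)].

Definition asymp_opposite_contributors E eps (u : (plane R)^nat) : Prop :=
  exists y1 y2 : (plane R)^nat,
    (forall k, extremal_contributors E eps (u k) = [set y1 k; y2 k]) /\
    (fun k => dot (eps^-1 *: (y1 k - u k)) (eps^-1 *: (y2 k - u k)))
      @ \oo --> (-1 : R).

Definition type_S6 E eps x : Prop :=
  (exists xi, extremal_directions E eps x = [set xi]) /\
  exists u : (plane R)^nat,
    [/\ forall k, (singularities E eps `\ x) (u k),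
        u @ \oo --> x & asymp_opposite_contributors E eps u].

Definition type_S7 E eps x : Prop :=
  exists xi1 xi2,
    [/\ extremal_directions E eps x = [set xi1; xi2], xi1 = - xi2 &
        forall xi, (xi = xi1 \/ xi = xi2) ->
          exists2 delta, 0 < delta &
          exists u : (plane R)^nat,
            [/\ forall k, (half_ball delta x xi `&` singularities E eps) (u k),
                u @ \oo --> x & asymp_opposite_contributors E eps u]].

Definition inaccessible E eps : set (plane R) :=
  [set x | singularities E eps x /\ (type_S6 E eps x \/ type_S7 E eps x)].

(* $f^{\xi,y}$. For [s] in [0, eps/2] and an extremal pair [(xi, y)] at [z],
   the set of [t] is nonempty and compact, so that [sup] is its maximum. The
   formula is meaningful only for such [s]; it is never used outside the
   interval. *)
Definition boundary_fun E eps z xi y (s : R) : R :=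
  sup [set t : R |
    edist (z + s *: xi + t *: (eps^-1 *: (z - y)))
          (E `&` closure (half_ball (eps / 2) y xi)) <= eps].

(* $g_{\xi,y}$ *)
Definition boundary_curve E eps z xi y (s : R) : plane R :=
  z + s *: xi + boundary_fun E eps z xi y s *: (eps^-1 *: (z - y)).

Definition local_boundary_repr E eps z r
    (A : plane R * plane R -> set R) : Prop :=
  [/\ 0 < r,
      forall p, extremal_pairs E eps z p ->
        closed (A p) /\ A p `<=` `[0, eps / 2] &
      boundary (nbhd_eps E eps) `&` closure (eball z r) =
      \bigcup_(p in extremal_pairs E eps z)
        (boundary_curve E eps z p.1 p.2 @` A p)].

Section OneSided.
Variable V : normedModType R.
Implicit Types f : R -> V.

Definition diff_quot f (s h : R) : V := h^-1 *: (f (s + h) - f s).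

Definition right_derivative f (s : R) : V := lim (diff_quot f s @ 0^'+).

Definition left_derivative f (s : R) : V := lim (diff_quot f s @ 0^'-).

Definition one_sided_derivable f (s : R) : Prop :=
  cvg (diff_quot f s @ 0^'+) /\ cvg (diff_quot f s @ 0^'-).

End OneSided.

(* [p] is the two-sided derivative of [f] at [s], and [q] is its second
   derivative there: the common derivative of the two functions $D^\pm f$. *)
Definition second_order_derivatives (f : R -> R) (s p q : R) : Prop :=
  [/\ is_derive s 1 f p,
      \forall t \near s, one_sided_derivable f t,
      is_derive s 1 (right_derivative f) q &
      is_derive s 1 (left_derivative f) q].

(* The quarter turn of the plane sending [xi] to [n] and [n] to [- xi], for an
   orthonormal frame [(xi, n)]. *)
Definition quarter_turn xi n v : plane R := dot v xi *: n - dot v n *: xi.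

(* Frenet equation $T' = \kappa |c'| N$ at parameter [s], where [T] is the unit
   tangent of [c] and [N] is [T] turned by a quarter turn in the orientation of
   [(xi, n)]; since $|c'| N$ is the quarter turn of $c'$, no norm appears. As
   the curves considered only have one-sided tangents in general, the equation
   is required of both the forward and the backward unit tangent. *)
Definition is_signed_curvature xi n (c : R -> plane R) (s kappa : R) : Prop :=
  exists v : plane R,
    [/\ v != 0 /\ is_derive s 1 c v,
        \forall t \near s, one_sided_derivable c t,
        is_derive s 1 (fun t => unit_vec (right_derivative c t))
                  (kappa *: quarter_turn xi n v) &
        is_derive s 1 (fun t => unit_vec (left_derivative c t))
                  (kappa *: quarter_turn xi n v)].

End Plane.

(* Main.v *)
Require Import Defs.
From HB Require Import structures.
From mathcomp Require Import all_boot all_order all_algebra.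
From mathcomp Require Import all_classical all_reals all_analysis.
From mathcomp Require Import ring lra.
Import Order.TTheory GRing.Theory Num.Theory.
Import numFieldNormedType.Exports.
Local Open Scope classical_set_scope.
Local Open Scope ring_scope.

(* In the frame [(xi, (z - y) / eps)] the function [f^{xi, y}] is a maximum of
   circular arcs of radius [eps] restricted to abscissas at distance at most
   [eps / 2] from their centres. Hence [f + C s^2] is convex for [C = 2 / eps],
   and by Lebesgue's theorem its monotone subgradient is differentiable almost
   everywhere; at such points [f] has the required second derivative, and the
   Frenet equation is a computation. Every [z] of the boundary that has an
   extremal pair admits a local boundary representation, inaccessible or not: a
   sequence of boundary points converging to [z], together with their
   contributors, accumulates in direction and contributor at an extremal pair
   [(xi, y)], and strict concavity of the arcs forces the nearby contributors to
   lie on the [xi]-side of [y]. If there is no extremal pair, then [z] is isolated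
   in the boundary. Locally the exceptional set is thus a finite union of
   Lipschitz images of null sets, or one point, and countably many such
   neighbourhoods suffice. *)

Set Implicit Arguments.
Unset Strict Implicit.
Unset Printing Implicit Defensive.

(** * Differentiability of monotone functions *)

Section Lebesgue.
Variable R : realType.
Notation mu := (@lebesgue_measure R).

(** The second derivative concerns $D^\pm f$ on a whole neighbourhood of $s$, also where the two
    differ. Both are therefore compared everywhere with one monotone function $M$, between whose
    neighbouring values they are wedged, so that they inherit its derivative at $s$. The half ball
    of radius $\varepsilon/2$ keeps the arcs over abscissas where their height is at least
    $\varepsilon/2$ and their slope at most 1. This yields $C = 2/\varepsilon$, and the Lipschitz
    constants 2 for $f$ and 3 for the curve. Contributors are neither unique nor continuous in the
    point. What controls them is that for contributors $q$ of $x$ and $y$ of $z$ one has $|x-q| =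
    |z-y| = \varepsilon$ and $|x-y|, |z-q| \ge \varepsilon$; expanding squares gives $\langle x-z,
    q-y\rangle \ge 0$. Null sets of parameters become null sets of the plane through the Hausdorff
    content, which is an outer measure and has the same null sets as needed here. *)

Lemma lebesgue_null_subset (A B : set R) :
  A `<=` B -> mu B = 0%E -> mu A = 0%E.
Proof.
move=> AB B0; apply/eqP; rewrite eq_le outer_measure_ge0 andbT -B0.
exact: le_outer_measure.
Qed.

Lemma lebesgue_null_setU (A B : set R) :
  mu A = 0%E -> mu B = 0%E -> mu (A `|` B) = 0%E.
Proof.
move=> A0 B0; apply/eqP; rewrite eq_le outer_measure_ge0 andbT.
have A0' : (mu A <= 0)%E by rewrite A0.
have B0' : (mu B <= 0)%E by rewrite B0.
apply: (le_trans (outer_measureU2 mu _ _)).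
by rewrite -(adde0 0%E); exact: leeD.
Qed.

Lemma lebesgue_null_bigcup (F : nat -> set R) :
  (forall n, mu (F n) = 0%E) -> mu (\bigcup_n F n) = 0%E.
Proof.
move=> F0; apply/eqP; rewrite eq_le outer_measure_ge0 andbT.
apply: (le_trans (outer_measure_sigma_subadditive mu F)).
by rewrite eseries0// => n _ _; exact: F0.
Qed.

Lemma lebesgue_null_bigcup_count (I : countType) (F : I -> set R) :
  (forall i, mu (F i) = 0%E) -> mu (\bigcup_i F i) = 0%E.
Proof.
move=> F0.
apply: (@lebesgue_null_subset _
  (\bigcup_n if unpickle n is Some i then F i else set0)).
  by move=> x [i _ Fix]; exists (pickle i) => //; rewrite pickleK.
apply: lebesgue_null_bigcup => n; case: unpickle => [i|]; first exact: F0.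
exact: outer_measure0.
Qed.

(* Vitali's theorem covers by the closed intervals; the open ones suffice, since
   the endpoints form a countable set. *)
Lemma vitali_rat (A : set R) (P : R -> R -> Prop) :
  (forall x, A x -> forall e : R, 0 < e -> exists u v : rat,
    [/\ ratr u < x < ratr v, ratr v - ratr u < e :> R & P (ratr u) (ratr v)]) ->
  exists (D : set nat) (u v : nat -> R),
  [/\ forall k, D k -> u k < v k /\ P (u k) (v k),
      trivIset D (fun k => `[u k, v k]%classic) &
      mu (A `\` \bigcup_(k in D) `]u k, v k[%classic) = 0%E].
Proof.
move=> AP.
(* A code that names no nondegenerate interval gets the default endpoints 0 and 1, because
   [vitali_theorem] wants a positive radius at every index. The default does no harm: only indices
   with [P (u k) (v k)] are selected. *)
pose c (k : nat) : rat * rat :=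
  if (unpickle k : option (rat * rat)%type) is Some uv then
    if uv.1 < uv.2 then uv else (0%Q, 1%Q) else (0%Q, 1%Q).
have c_lt k : (c k).1 < (c k).2.
  by rewrite /c; case: unpickle => [uv|//]; case: ifP.
pose u k : R := ratr (c k).1; pose v k : R := ratr (c k).2.
have uv k : u k < v k by rewrite ltr_rat.
have lE k : (u k + v k) / 2 - (v k - u k) / 2 = u k by field.
have rE k : (u k + v k) / 2 + (v k - u k) / 2 = v k by field.
pose B k := ball ((u k + v k) / 2) ((v k - u k) / 2).
have rB k : (radius (B k))%:num = (v k - u k) / 2.
  by rewrite radius_ball_num//; have := uv k; lra.
have B0 k : 0 < (radius (B k))%:num by rewrite rB; have := uv k; lra.
have BE k : B k = `]u k, v k[%classic.
  by rewrite /B ball_itv lE rE.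
have cBE k : closure (B k) = `[u k, v k]%classic.
  rewrite /B closure_ballE closed_ball_itv; last by have := uv k; lra.
  by rewrite lE rE.
have AB : vitali_cover A B [set k | P (u k) (v k)].
  split=> [i|x Ax e e0]; first exact: is_ball_ball.
  have [u0 [v0 [/andP[ux xv] uve Puv]]] := AP x Ax e e0.
  have uv0 : u0 < v0 by rewrite -(ltr_rat R); exact: lt_trans xv.
  have cE : c (pickle (u0, v0)) = (u0, v0) by rewrite /c pickleK uv0.
  move: (pickle _) cE => k cE; exists k; split.
  - by rewrite /mkset /u /v cE.
  - by rewrite BE /u /v cE /= in_itv /= ux.
  - by rewrite rB /u /v cE /=; move: ux xv uve; lra.
have [D [_ DV tD D0]] := vitali_theorem B0 AB.
exists D, u, v; split=> [k /DV//||].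
- rewrite (_ : (fun k => _) = closure \o B)//.
  by apply/funext => k; rewrite /= cBE.
- apply: (@lebesgue_null_subset _ ((A `\` \bigcup_(k in D) closure (B k)) `|`
     (\bigcup_k ([set u k] `|` [set v k])))).
    move=> x [Ax nx]; have [[k Dk]|nx'] := pselect ((\bigcup_(k in D) closure (B k)) x).
      rewrite cBE /= in_itv /= => /andP[ux xv]; right; exists k => //.
      move: ux; rewrite le_eqVlt => /orP[/eqP ->|ux]; first by left.
      move: xv; rewrite le_eqVlt => /orP[/eqP ->|xv]; first by right.
      by case: nx; exists k => //=; rewrite in_itv /= ux.
    by left.
  apply: lebesgue_null_setU => //; apply: lebesgue_null_bigcup => k.
  apply: countable_lebesgue_measure0.
  by apply: finite_set_countable; rewrite finite_setU; split; exact: finite_set1.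
Qed.

End Lebesgue.

Section MonotoneSlopes.
Variables (R : realType) (M : R -> R).
Hypothesis ndM : {homo M : x y / x <= y}.
Notation mu := (@lebesgue_measure R).

(* Only intervals with rational endpoints, so that Vitali's theorem applies to a
   countable family; for a monotone function their slopes control all others. *)
Definition frequently_straddled (P : R -> R -> Prop) (x : R) :=
  forall e : R, 0 < e -> exists u v : rat,
    [/\ ratr u < x < ratr v, ratr v - ratr u < e :> R & P (ratr u) (ratr v)].

(** Confining the Vitali intervals to an open [W] bounds their total length by the measure of
    [W]. *)
Lemma frequently_straddled_open (W : set R) P x : open W -> W x ->
  frequently_straddled P x ->
  frequently_straddled (fun u v => P u v /\ `[u, v]%classic `<=` W) x.
Proof.
move=> oW Wx Px e e0.
have [d /= d0 dW] := open_subball oW Wx.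
have m0 : 0 < Num.min e (d / 2) by rewrite lt_min e0/=; lra.
have [u [v [uxv uve Puv]]] := Px _ m0.
move: uve; rewrite lt_min => /andP[uve uvd].
exists u, v; split=> //.
split=> // y /=; rewrite in_itv /= => uyv; apply: (dW (d / 2)) => //=.
- by rewrite sub0r normrN gtr0_norm; lra.
- lra.
- by rewrite /ball /= ltr_norml; lra.
Qed.

Lemma lebesgue_measure_itvoo (a b : R) : a <= b ->
  mu `]a, b[%classic = (b - a)%:E.
Proof.
rewrite lebesgue_measure_itv /= lte_fin EFinD; case: ltP => // ba ab.
by have -> : a = b by [lra]; rewrite -EFinD subrr.
Qed.

(** The images must be open: [M] may take the same value at the right end of one interval and at the
    left end of another. A common point of two open images forces the larger left endpoint into both
    intervals. *)
Lemma trivIset_monotone_image (D : set nat) (u v : nat -> R) :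
  (forall k, D k -> u k < v k) ->
  trivIset D (fun k => `[u k, v k]%classic) ->
  trivIset D (fun k => `]M (u k), M (v k)[%classic).
Proof.
move=> uv tD i j Di Dj [y [/=]]; rewrite !in_itv /= => yi yj.
have uivj : u i < v j.
  by rewrite ltNge; apply/negP => /ndM; move: yi yj; lra.
have ujvi : u j < v i.
  by rewrite ltNge; apply/negP => /ndM; move: yi yj; lra.
apply: tD => //; exists (Num.max (u i) (u j)).
have := uv _ Di; have := uv _ Dj => uvj uvi.
by split; rewrite /= in_itv /= le_max ge_max lexx ?orbT /= !ltW.
Qed.

Lemma trivIset_open_closed (D : set nat) (u v : nat -> R) :
  trivIset D (fun k => `[u k, v k]%classic) ->
  trivIset D (fun k => `]u k, v k[%classic).
Proof.
move=> tD i j Di Dj [y [yi yj]]; apply: tD => //; exists y.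
by split; apply: subset_itv_oo_cc.
Qed.

Lemma lebesgue_le_subset (A B : set R) : A `<=` B -> (mu A <= mu B)%E.
Proof. by move=> AB; exact: le_outer_measure. Qed.

Lemma lebesgue_le_setI (A U : set R) :
  mu (A `\` U) = 0%E -> (mu A <= mu (A `&` U))%E.
Proof.
move=> A0; have A0' : (mu (A `\` U) <= 0)%E by rewrite A0.
rewrite -[X in (mu X <= _)%E](setUIDK A U).
apply: (le_trans (outer_measureU2 mu _ _)).
by rewrite -[leRHS]adde0; exact: leeD.
Qed.

(* [M] maps disjoint intervals to disjoint intervals. *)
Lemma measure_steep_le (a b q : R) (A : set R) : 0 < q ->
  A `<=` `]a, b[%classic ->
  (forall x, A x ->
    frequently_straddled (fun u v => q * (v - u) < M v - M u) x) ->
  (q%:E * mu A <= mu `]M a, M b[%classic)%E.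
Proof.
move=> q0 Aab Aq.
have oab : open (`]a, b[%classic : set R) by exact: interval_open.
have [D [u [v [Duv tD D0]]]] := @vitali_rat R A
  (fun u v => q * (v - u) < M v - M u /\ `[u, v]%classic `<=` `]a, b[%classic)
  (fun x Ax => frequently_straddled_open oab (Aab x Ax) (Aq x Ax)).
have uv k : D k -> u k < v k by case/Duv.
have ab k : D k -> a <= u k /\ v k <= b.
  move=> /[dup] /uv uvk /Duv [_ [_ sub]].
  have := sub (u k); have := sub (v k); rewrite /= !in_itv /= !lexx ltW//=.
  by move=> /(_ isT) ? /(_ isT); lra.
have muA : (mu A <= mu (\bigcup_(k in D) `]u k, v k[%classic))%E.
  apply: (le_trans (lebesgue_le_setI D0)).
  by apply: lebesgue_le_subset; exact: subIsetr.
apply: (le_trans (lee_wpmul2l _ muA)); first by rewrite lee_fin ltW.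
apply: (@le_trans _ _ (mu (\bigcup_(k in D) `]M (u k), M (v k)[%classic))); last first.
  apply: lebesgue_le_subset => y [k Dk /=]; rewrite !in_itv /=.
  have [/ndM ? /ndM ?] := ab _ Dk; lra.
rewrite measure_bigcup; [|by move=> k _; exact: measurable_itv|exact: trivIset_open_closed].
rewrite measure_bigcup; [|by move=> k _; exact: measurable_itv|exact: trivIset_monotone_image].
rewrite -nneseriesZl//; apply: lee_nneseries => [k _ _|k kD]; first by rewrite mule_ge0 ?measure_ge0// lee_fin ltW.
have Dk := set_mem kD.
suff : (q%:E * mu `]u k, v k[%classic <= mu `]M (u k), M (v k)[%classic)%E by [].
rewrite !lebesgue_measure_itvoo ?ndM ?(ltW (uv _ Dk))//.
by rewrite -EFinM lee_fin; have [_ [/ltW]] := Duv _ Dk.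
Qed.

(** Take an open [W] around [A] of measure at most [mu A + e], and cover [A] by flat intervals
    inside [W]. On each of them [M] grows by at most [p] times the length, while [measure_steep_le]
    makes it grow by at least [q] times the measure of the part of [A] inside. Summing,
    [q * mu A <= p * (mu A + e)] for every [e]. *)
Lemma steep_and_flat_null (a b p q : R) (A : set R) : 0 <= p < q ->
  A `<=` `]a, b[%classic ->
  (forall x, A x ->
    frequently_straddled (fun u v => M v - M u < p * (v - u)) x) ->
  (forall x, A x ->
    frequently_straddled (fun u v => q * (v - u) < M v - M u) x) ->
  mu A = 0%E.
Proof.
move=> /andP[p0 pq] Aab Ap Aq; have q0 := le_lt_trans p0 pq.
have muAfin : mu A \is a fin_num.
  rewrite ge0_fin_numE ?outer_measure_ge0//.
  apply: (le_lt_trans (lebesgue_le_subset Aab)).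
  by rewrite lebesgue_measure_itv /=; case: ifP => _; rewrite ?ltry// -EFinB ltry.
have step e : 0 < e -> (q%:E * mu A <= p%:E * (mu A + e%:E))%E.
  move=> e0; have [W [oW AW muW]] := outer_measure_open_le A e0.
  have [|D [u [v [Duv tD D0]]]] := @vitali_rat R A
    (fun u v => M v - M u < p * (v - u) /\ `[u, v]%classic `<=` W).
    by move=> x Ax; exact: frequently_straddled_open (AW x Ax) (Ap x Ax).
  have uv k : D k -> u k < v k by case/Duv.
  have muA : (mu A <= \sum_(k <oo | k \in D) mu (A `&` `]u k, v k[%classic))%E.
    apply: (le_trans (lebesgue_le_setI D0)).
    rewrite setI_bigcupr bigcup_mkcond eseries_mkcond.
    apply: (le_trans (outer_measure_sigma_subadditive mu _)).
    apply: lee_nneseries => [k _ _|k _]; first exact: outer_measure_ge0.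
    by case: ifP => //; rewrite outer_measure0.
  apply: (le_trans (lee_wpmul2l _ muA)); first by rewrite lee_fin ltW.
  apply: (@le_trans _ _ (p%:E * mu W)%E); last by apply: lee_wpmul2l.
  apply: (@le_trans _ _ (p%:E * mu (\bigcup_(k in D) `]u k, v k[%classic))%E); last first.
    apply: lee_wpmul2l => //; apply: lebesgue_le_subset => x [k Dk].
    by move=> /subset_itv_oo_cc; exact: (Duv _ Dk).2.2.
  rewrite measure_bigcup; [|by move=> k _; exact: measurable_itv|exact: trivIset_open_closed].
  rewrite -!nneseriesZl; try by move=> k _; exact: outer_measure_ge0.
  apply: lee_nneseries => [k _ _|k kD].
    by rewrite mule_ge0 ?outer_measure_ge0// lee_fin ltW.
  have Dk := set_mem kD.
  have := @measure_steep_le (u k) (v k) q (A `&` `]u k, v k[%classic) q0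
    (@subIsetr _ _ _) (fun x Ax => Aq x Ax.1).
  move=> /le_trans; apply.
  suff : (mu `]M (u k), M (v k)[%classic <= p%:E * mu `]u k, v k[%classic)%E by [].
  rewrite !lebesgue_measure_itvoo ?ndM ?(ltW (uv _ Dk))//.
  by rewrite -EFinM lee_fin; have [_ [/ltW]] := Duv _ Dk.
apply/eqP; rewrite -(fineK muAfin) eqe eq_le fine_ge0 ?outer_measure_ge0// andbT.
rewrite leNgt; apply/negP => m0.
(* With this [e] the excess [p * e] is at most half of [(q - p) * mu A]; the denominator has [p + 1]
   instead of [p] to allow [p = 0]. *)
have e0 : 0 < (q - p) * fine (mu A) / (2 * (p + 1)).
  by rewrite divr_gt0// ?mulr_gt0//; lra.
have := step _ e0; rewrite -(fineK muAfin) -EFinD -!EFinM lee_fin.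
set m := fine _ in m0 *.
rewrite mulrDr => H.
have H1 : p * ((q - p) * m / (2 * (p + 1))) <= (q - p) * m / 2.
  rewrite (_ : _ * _ = ((q - p) * m / 2) * (p / (p + 1))); last by field; lra.
  rewrite ler_piMr// ?divr_ge0 ?mulr_ge0//; try lra.
  by rewrite ler_pdivrMr; lra.
have H2 : 0 < (q - p) * m by rewrite mulr_gt0//; lra.
by move: H H1 H2; set t := p * (_ / _); lra.
Qed.

End MonotoneSlopes.

Section MonotoneDerivable.
Variables (R : realType) (M : R -> R).
Hypothesis ndM : {homo M : x y / x <= y}.
Notation mu := (@lebesgue_measure R).

Let ndM' (a b : R) : a <= b -> M a <= M b. Proof. exact: ndM. Qed.

Lemma not_frequently_straddled (P : R -> R -> Prop) x :
  ~ frequently_straddled P x -> exists2 d : R, 0 < d &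
  forall u v : rat, ratr u < x < ratr v -> ratr v - ratr u < d :> R ->
    ~ P (ratr u) (ratr v).
Proof.
move=> nP; apply: contrapT => nd; apply: nP => e e0.
apply: contrapT => ne; apply: nd; exists e => // u v uxv uve Puv.
by apply: ne; exists u, v.
Qed.

Lemma rat_between (a b : R) : a < b -> exists q : rat, a < ratr q < b.
Proof. by move=> /rat_in_itvoo[q]; rewrite in_itv /= => ?; exists q. Qed.

(** A one-sided interval at [x] is compared with a rational interval that overshoots [x] slightly.
    For the lower bounds the overshoot must be subtracted again; it is small because the upper slope
    bound, applied to a short interval across [x], limits the jump of [M] there. *)
Lemma straddle_one_sided (x L e d : R) : 0 <= L -> 0 < e -> 0 < d ->
  (forall u v : rat, ratr u < x < ratr v -> ratr v - ratr u < d :> R ->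
    (L - e) * (ratr v - ratr u) <= M (ratr v) - M (ratr u)
      <= (L + e) * (ratr v - ratr u)) ->
  forall h, 0 < h < d / 2 ->
    ((L - e) * h <= M (x + h) - M x <= (L + e) * h) /\
    ((L - e) * h <= M x - M (x - h) <= (L + e) * h).
Proof.
move=> L0 e0 d0 H h /andP[h0 hd].
have Le0 : 0 < L + e by lra.
(* The factor 3 counts errors of size at most [(L + e) * t]: one for the far endpoint and two for
   the oscillation of [M] across [x]. *)
have key eta : 0 < eta -> exists2 t, 0 < t < h & t <= d / 8 /\ 3 * (L + e) * t <= eta.
  move=> eta0; exists (Num.min (h / 2) (Num.min (d / 8) (eta / (3 * (L + e))))).
    by rewrite !lt_min gt_min !divr_gt0 ?mulr_gt0//; lra.
  split; first by rewrite !ge_min lexx orbT.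
  by rewrite mulrC -ler_pdivlMr ?mulr_gt0// !ge_min lexx !orbT.
have nearx t : 0 < t <= d / 8 -> exists w1 w2 : rat,
    [/\ x - t < ratr w1 < x, x < ratr w2 < x + t &
        M (ratr w2) - M (ratr w1) <= (L + e) * (2 * t)].
  move=> t0; have [w1 /andP[w1t w1x]] : exists q : rat, x - t < ratr q < x by apply: rat_between; lra.
  have [w2 /andP[w2x w2t]] : exists q : rat, x < ratr q < x + t by apply: rat_between; lra.
  exists w1, w2; split; [lra|lra|].
  have /andP[_ /le_trans] := H w1 w2 ltac:(lra) ltac:(lra); apply.
  by rewrite ler_pM2l//; lra.
have down (a b : R) : a <= b -> (L - e) * a <= (L - e) * b \/ L - e <= 0.
  by move=> ab; have [l0|l0] := leP (L - e) 0; [right|left; rewrite ler_pM2l].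
split; apply/andP; split; apply/ler_addgt0Pr => eta eta0;
    have [t t0 [td te]] := key _ eta0.
- have [l0|l0] := leP (L - e) 0.
    have : (L - e) * h <= 0 by rewrite mulr_le0_ge0 // ltW.
    by have := @ndM' x (x + h) ltac:(lra); lra.
  have [w1 [w2 [w1x w2x w12]]] := nearx t ltac:(lra).
  have [v vh] : exists q : rat, x + h - t < ratr q < x + h by apply: rat_between; lra.
  have /andP[Hv _] := H w1 v ltac:(lra) ltac:(lra).
  have := @ndM' (ratr v) (x + h) ltac:(lra); have := @ndM' x (ratr w2) ltac:(lra).
  have : (L - e) * (h - t) <= (L - e) * (ratr v - ratr w1).
    by rewrite ler_pM2l//; lra.
  have : 0 < e * t by rewrite mulr_gt0//; lra.
  by lra.
- have [w1 w1x] : exists q : rat, x - t < ratr q < x by apply: rat_between; lra.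
  have [v vh] : exists q : rat, x + h < ratr q < x + h + t by apply: rat_between; lra.
  have /andP[_ Hv] := H w1 v ltac:(lra) ltac:(lra).
  have := @ndM' (ratr w1) x ltac:(lra); have := @ndM' (x + h) (ratr v) ltac:(lra).
  have : (L + e) * (ratr v - ratr w1) <= (L + e) * (h + 2 * t).
    by rewrite ler_pM2l//; lra.
  have : 0 < (L + e) * t by rewrite mulr_gt0//; lra.
  by lra.
- have [l0|l0] := leP (L - e) 0.
    have : (L - e) * h <= 0 by rewrite mulr_le0_ge0 // ltW.
    by have := @ndM' (x - h) x ltac:(lra); lra.
  have [w1 [w2 [w1x w2x w12]]] := nearx t ltac:(lra).
  have [v vh] : exists q : rat, x - h < ratr q < x - h + t by apply: rat_between; lra.
  have /andP[Hv _] := H v w2 ltac:(lra) ltac:(lra).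
  have := @ndM' (x - h) (ratr v) ltac:(lra); have := @ndM' (ratr w1) x ltac:(lra).
  have : (L - e) * (h - t) <= (L - e) * (ratr w2 - ratr v).
    by rewrite ler_pM2l//; lra.
  have : 0 < e * t by rewrite mulr_gt0//; lra.
  by lra.
- have [w2 w2x] : exists q : rat, x < ratr q < x + t by apply: rat_between; lra.
  have [v vh] : exists q : rat, x - h - t < ratr q < x - h by apply: rat_between; lra.
  have /andP[_ Hv] := H v w2 ltac:(lra) ltac:(lra).
  have := @ndM' x (ratr w2) ltac:(lra); have := @ndM' (ratr v) (x - h) ltac:(lra).
  have : (L + e) * (ratr w2 - ratr v) <= (L + e) * (h + 2 * t).
    by rewrite ler_pM2l//; lra.
  have : 0 < (L + e) * t by rewrite mulr_gt0//; lra.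
  by lra.
Qed.

Lemma straddle_derivable (x L : R) : 0 <= L ->
  (forall e : R, 0 < e -> exists2 d : R, 0 < d &
    forall u v : rat, ratr u < x < ratr v -> ratr v - ratr u < d :> R ->
    (L - e) * (ratr v - ratr u) <= M (ratr v) - M (ratr u)
      <= (L + e) * (ratr v - ratr u)) ->
  derivable M x 1.
Proof.
move=> L0 H; apply: (cvgP L); apply/cvgrPdist_le => e e0.
have [d d0 /(straddle_one_sided L0 e0 d0) {}H] := H e e0.
have d20 : 0 < d / 2 by lra.
near=> h.
have h0 : h != 0 by near: h; exact: nbhs_dnbhs_neq.
have : `|h| < d / 2.
  near: h; apply: nbhs_dnbhs; apply/nbhs_ballP; exists (d / 2) => //= y.
  by rewrite /ball /= sub0r normrN.
rewrite /GRing.scale /= mulr1 distrC ler_distl.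
move: h0; rewrite neq_lt => /orP[h0|h0].
  rewrite ltr0_norm// => hd; have [_] := H (- h) ltac:(lra).
  rewrite opprK (addrC h) => /andP[H1 H2].
  rewrite mulrC ler_ndivlMr// ler_ndivrMr//.
  by apply/andP; split; lra.
rewrite gtr0_norm// => hd; have [+ _] := H h ltac:(lra).
rewrite (addrC h) => /andP[H1 H2].
rewrite mulrC ler_pdivlMr// ler_pdivrMr//.
by apply/andP; split; lra.
Unshelve. all: by end_near. Qed.

(** The derivative is [inf S], the upper limit of the straddling slopes at [x]. Were the slopes
    frequently below [inf S - e], two rationals [p < q] between [inf S - e] and [inf S] would be
    frequently undershot and overshot respectively, against the second hypothesis. *)
Lemma derivable_of_not_straddled (x K : R) :
  ~ frequently_straddled (fun u v => K * (v - u) < M v - M u) x ->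
  (forall p q : rat, 0 <= p < q ->
    frequently_straddled (fun u v => M v - M u < ratr p * (v - u)) x ->
    ~ frequently_straddled (fun u v => ratr q * (v - u) < M v - M u) x) ->
  derivable M x 1.
Proof.
move=> xK xpq.
pose S := [set c : R | ~ frequently_straddled (fun u v => c * (v - u) < M v - M u) x].
have S0 c : S c -> 0 <= c.
  rewrite leNgt => Sc; apply/negP => c0; apply: Sc => e e0.
  have [u ux] : exists q : rat, x - e / 2 < ratr q < x by apply: rat_between; lra.
  have [v xv] : exists q : rat, x < ratr q < x + e / 2 by apply: rat_between; lra.
  exists u, v; split; [lra|lra|].
  have : c * (ratr v - ratr u) < 0 by rewrite nmulr_rlt0//; lra.
  by have := @ndM' (ratr u) (ratr v) ltac:(lra); lra.
have hS : has_inf S by split; [exists K|exists 0 => c /S0].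
have L0 : 0 <= inf S by apply: lb_le_inf; [exists K|move=> c /S0].
apply: (straddle_derivable L0) => e e0.
have [c /not_frequently_straddled[d1 d10 H1] cL] := inf_adherent e0 hS.
have [d2 d20 H2] : exists2 d2 : R, 0 < d2 & forall u v : rat,
    ratr u < x < ratr v -> ratr v - ratr u < d2 :> R ->
    (inf S - e) * (ratr v - ratr u) <= M (ratr v) - M (ratr u).
  have [Le|Le] := ltP (inf S - e) 0.
    exists 1 => // u v uxv _.
    have : (inf S - e) * (ratr v - ratr u) < 0 by rewrite nmulr_rlt0//; lra.
    by have := @ndM' (ratr u) (ratr v) ltac:(lra); lra.
  have [q qL] : exists q : rat, inf S - e < ratr q < inf S by apply: rat_between; lra.
  have [p pq] : exists p : rat, inf S - e < ratr p < (ratr q : R) by apply: rat_between; lra.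
  have pq' : 0 <= p < q.
    by rewrite -(ler_rat R) -(ltr_rat R) raddf0; lra.
  have nSq : frequently_straddled (fun u v => ratr q * (v - u) < M v - M u) x.
    apply: contrapT => Sq.
    by have := ge_inf hS.2 (Sq : S (ratr q)); lra.
  have [d2 d20 H2] := not_frequently_straddled (fun H => xpq p q pq' H nSq).
  exists d2 => // u v uxv uvd; have /negP := H2 u v uxv uvd.
  rewrite -leNgt => H3; apply: le_trans H3; apply: ler_wpM2r; lra.
exists (Num.min d1 d2); first by rewrite lt_min d10.
move=> u v uxv; rewrite lt_min => /andP[ud1 ud2]; rewrite H2//=.
have /negP := H1 u v uxv ud1; rewrite -leNgt => /le_trans; apply.
by apply: ler_wpM2r; lra.
Qed.

(** At a bad point the slopes are either unbounded ([Z]) or frequently on both sides of a gap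
    between two rationals ([F]). The set [Z n] is null since [measure_steep_le] bounds
    [K * mu (Z n)] by [M n - M (- n)] for every [K]. The truncation to bounded intervals keeps these
    quantities finite. *)
Theorem monotone_derivable_ae : mu [set x | ~ derivable M x 1] = 0%E.
Proof.
pose Z (n : nat) := [set x | `]-n%:R, n%:R[%classic x /\ forall K : nat,
  frequently_straddled (fun u v => K%:R * (v - u) < M v - M u) x].
pose F (i : nat * (rat * rat)) := [set x | [/\ `]-i.1%:R, i.1%:R[%classic x,
  (0 <= i.2.1 < i.2.2)%R,
  frequently_straddled (fun u v => M v - M u < ratr i.2.1 * (v - u)) x &
  frequently_straddled (fun u v => ratr i.2.2 * (v - u) < M v - M u) x]].
have Z0 n : mu (Z n) = 0%E.
  have Zn : Z n `<=` `]-n%:R, n%:R[%classic by move=> x [].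
  have Zfin : mu (Z n) \is a fin_num.
    rewrite ge0_fin_numE ?outer_measure_ge0//.
    apply: (le_lt_trans (lebesgue_le_subset Zn)).
    by rewrite lebesgue_measure_itv /=; case: ifP => _; rewrite ?ltry// -EFinB ltry.
  apply/eqP; rewrite -(fineK Zfin) eqe eq_le fine_ge0 ?outer_measure_ge0// andbT.
  rewrite leNgt; apply/negP => m0; set m := fine _ in m0.
  pose K := (Num.truncn ((M n%:R - M (- n%:R)) / m)).+1.
  have K0 : 0 < K%:R :> R by rewrite ltr0n.
  have := measure_steep_le ndM K0 Zn (fun x Zx => Zx.2 K).
  rewrite lebesgue_measure_itvoo; last by apply: ndM; have := ler0n R n; lra.
  rewrite -(fineK Zfin) -EFinM lee_fin -/m; apply/negP; rewrite -ltNge.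
  by rewrite -ltr_pdivrMr//; exact: truncnS_gt.
have F0 i : mu (F i) = 0%E.
  have [pq|npq] := boolP (0 <= i.2.1 < i.2.2).
    apply: (@steep_and_flat_null _ _ ndM (- i.1%:R) i.1%:R (ratr i.2.1) (ratr i.2.2)).
    - by move: pq; rewrite -(ler_rat R) -(ltr_rat R) raddf0.
    - by move=> x [].
    - by move=> x [].
    - by move=> x [].
  by rewrite (_ : F i = set0) ?outer_measure0// -subset0 => x [_ pq]; rewrite pq in npq.
apply: (@lebesgue_null_subset _ _ ((\bigcup_n Z n) `|` (\bigcup_i F i))); last first.
  by apply: lebesgue_null_setU; [exact: lebesgue_null_bigcup|exact: lebesgue_null_bigcup_count].
move=> x /= nd; apply: contrapT => /not_orP[nZ nF]; apply: nd.
have [n xn] : exists n : nat, `]-n%:R, n%:R[%classic x.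
  exists (Num.truncn `|x|).+1; rewrite /= in_itv /= -ltr_norml; exact: truncnS_gt.
have [K xK] : exists K : nat, ~ frequently_straddled (fun u v => K%:R * (v - u) < M v - M u) x.
  by apply: contrapT => nK; apply: nZ; exists n => //; split=> // K; apply: contrapT => xK; apply: nK; exists K.
apply: (derivable_of_not_straddled xK) => p q pq xp xq.
by apply: nF; exists (n, (p, q)).
Qed.

End MonotoneDerivable.

(** * Second derivatives of semiconvex functions *)

Section Subgradient.
Variables (R : realType) (c : R) (G M : R -> R).
Hypothesis GM : forall s t, 0 <= s <= c -> 0 <= t <= c ->
  G s + M s * (t - s) <= G t.

(** The quotient at step [h] lies between [M t] and [M (t + h)], and it increases with [h] because
    [G] lies above its supporting line at the intermediate point [t + h1]. The limit is thus an
    infimum. *)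
Lemma subgradient_right (t : R) : 0 < t < c -> exists l : R,
  [/\ diff_quot G t h @[h --> 0^'+] --> l, M t <= l &
      forall u, t < u < c -> l <= M u].
Proof.
move=> t0c.
have lbM h : 0 < h < c - t -> M t <= diff_quot G t h.
  move=> h0; rewrite /diff_quot /GRing.scale /= mulrC ler_pdivlMr; last by lra.
  have := @GM t (t + h) ltac:(lra) ltac:(lra).
  by rewrite (_ : t + h - t = h); [lra|ring].
have ubM h : 0 < h < c - t -> diff_quot G t h <= M (t + h).
  move=> h0; rewrite /diff_quot /GRing.scale /= mulrC ler_pdivrMr; last by lra.
  have := @GM (t + h) t ltac:(lra) ltac:(lra).
  by rewrite (_ : t - (t + h) = - h); [rewrite mulrN; lra|ring].
have mono : {in `]0, (c - t)[ &, nondecreasing_fun (diff_quot G t)}.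
  move=> h1 h2; rewrite !in_itv /= => h1t h2t.
  rewrite le_eqVlt => /orP[/eqP -> //|h12].
  have := @GM (t + h1) (t + h2) ltac:(lra) ltac:(lra).
  rewrite (_ : t + h2 - (t + h1) = h2 - h1); last by ring.
  have /[dup] := ubM h1 h1t.
  rewrite {1}/diff_quot /GRing.scale /= mulrC ler_pdivrMr; last by lra.
  move=> H1 H2 H3.
  rewrite /diff_quot /GRing.scale /= ![_^-1 * _]mulrC ler_pdivlMr; last by lra.
  rewrite mulrAC ler_pdivrMr; last by lra.
  have : (G (t + h1) - G t) * (h2 - h1) <= (M (t + h1) * h1) * (h2 - h1).
    by apply: ler_wpM2r => //; lra.
  have : (M (t + h1) * (h2 - h1)) * h1 <= (G (t + h2) - G (t + h1)) * h1.
    by apply: ler_wpM2r; lra.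
  by lra.
have lb : has_lbound (diff_quot G t @` [set` `]0, (c - t)[ ]).
  by exists (M t); move=> y [h]; rewrite /= in_itv /= => h0 <-; exact: lbM.
have ct : (BRight 0 < BLeft (c - t) :> itv_bound R)%O by rewrite bnd_simp; lra.
have cvgl := nondecreasing_at_right_cvgr ct mono lb.
exists (inf (diff_quot G t @` [set` `]0, (c - t)[ ])); split => //.
- apply: lb_le_inf => [|y [h]].
    by exists (diff_quot G t ((c - t) / 2)), ((c - t) / 2) => //=; rewrite in_itv /=; lra.
  by rewrite /= in_itv /= => h0 <-; exact: lbM.
- move=> u tu; apply: (@le_trans _ _ (diff_quot G t (u - t))).
    by apply: ge_inf => //; exists (u - t) => //=; rewrite in_itv /=; lra.
  by have := ubM (u - t) ltac:(lra); rewrite (addrC t) subrK.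
Qed.

End Subgradient.

(** The reflection [s |-> c - s] reduces this to the right-hand case, with subgradient
    [- M (c - s)]. *)
Lemma subgradient_left (R : realType) (c : R) (G M : R -> R) :
  (forall s t, 0 <= s <= c -> 0 <= t <= c -> G s + M s * (t - s) <= G t) ->
  forall t, 0 < t < c -> exists l : R,
  [/\ diff_quot G t h @[h --> 0^'-] --> l, l <= M t &
      forall u, 0 < u < t -> M u <= l].
Proof.
move=> GM t t0c.
have GM' s s' : 0 <= s <= c -> 0 <= s' <= c ->
    G (c - s) + - M (c - s) * (s' - s) <= G (c - s').
  move=> s0 s0'; have := @GM (c - s) (c - s') ltac:(lra) ltac:(lra).
  by rewrite (_ : c - s' - (c - s) = - (s' - s)); [rewrite mulrN mulNr|ring].
have [l [lcvg lM lu]] := subgradient_right GM' (ltac:(lra) : 0 < c - t < c).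
exists (- l); split.
- apply/cvg_at_leftNP; rewrite oppr0.
  apply: cvg_trans (cvgN lcvg); apply: near_eq_cvg; near=> h.
  rewrite /= /diff_quot /= invrN scaleNr; congr (- (_ *: (G _ - G _))); ring.
- by move: lM; rewrite (_ : c - (c - t) = t); [lra|ring].
- move=> u u0; have := lu (c - u) ltac:(lra).
  by rewrite (_ : c - (c - u) = u); [lra|ring].
Unshelve. all: by end_near. Qed.

(** [A (s + k)] lies between [M (s + k - h')] and [M (s + k + h')] for small [h']. The first-order
    expansion of [M] at [s] controls both ends, and letting [h'] tend to 0 transfers it to [A]. Here
    [A] stands for a one-sided derivative, which may differ from [M] at the jumps of [M]. *)
Lemma monotone_sandwich_derive (R : realType) (c s q : R) (M A : R -> R) :
  0 < s < c -> is_derive s 1 M q ->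
  (forall t u, 0 < t < c -> 0 < u < c -> u < t -> M u <= A t) ->
  (forall t u, 0 < t < c -> 0 < u < c -> t < u -> A t <= M u) ->
  A s = M s /\ is_derive s 1 A q.
Proof.
move=> s0c [dM Mq] MA AM.
have bound e : 0 < e -> exists2 d, 0 < d & forall k, `|k| < d ->
    `|M (s + k) - M s - q * k| <= e * `|k|.
  move=> e0; have : h^-1 *: ((M \o shift s) (h *: 1) - M s) @[h --> 0^'] --> q.
    by rewrite -Mq; exact: dM.
  move=> /cvgrPdist_le /(_ e e0) /nbhs_ballP[d /= d0 H]; exists d => // k kd.
  have [->|k0] := eqVneq k 0; first by rewrite addr0 subrr mulr0 subr0 normr0 mulr0.
  have := H k; rewrite /ball /= sub0r normrN => /(_ kd k0).
  rewrite /GRing.scale /= mulr1 -(ler_pM2r (_ : 0 < `|k|)) ?normr_gt0//.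
  rewrite -normrM mulrBl mulrAC mulVf// mul1r distrC.
  by rewrite (addrC k).
have As e : 0 < e -> exists2 d, 0 < d & forall h, `|h| < d ->
    `|A (s + h) - M s - q * h| <= e * `|h|.
  move=> e0; have [d d0 H] := bound e e0.
  exists (Num.min (d / 2) (Num.min (s / 2) ((c - s) / 2))).
    by rewrite !lt_min; apply/and3P; split; lra.
  move=> k; rewrite !lt_min => /and3P[kd ks kc].
  have {ks kc} ks : 0 < s + k < c by move: ks kc; rewrite !ltr_norml; lra.
  apply/ler_addgt0Pr => eta eta0.
  pose w := `|q| + e; have w0 : 0 < w by rewrite /w; have := normr_ge0 q; lra.
  (* The first three bounds keep [s + k - h'] and [s + k + h'] in the range of the expansion and in
     the domain; the last absorbs the error [(|q| + e) * h'] into [eta]. *)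
  pose h' := Num.min (d / 2) (Num.min ((s + k) / 2) (Num.min ((c - (s + k)) / 2) (eta / w))).
  have h'0 : 0 < h' by rewrite !lt_min; apply/and4P; split; rewrite ?(divr_gt0 eta0)//; lra.
  have [h'd h's h'c h'eta] : [/\ h' <= d / 2, h' <= (s + k) / 2, h' <= (c - (s + k)) / 2 & w * h' <= eta].
    split; last (rewrite mulrC -ler_pdivlMr//);
      by rewrite /h' !ge_min ?lexx ?orbT.
  have Hp := MA (s + k) (s + (k - h')) ltac:(lra) ltac:(lra) ltac:(lra).
  have Hm := AM (s + k) (s + (k + h')) ltac:(lra) ltac:(lra) ltac:(lra).
  have kp : `|k + h'| <= `|k| + h' by have := ler_normD k h'; rewrite (gtr0_norm h'0).
  have km : `|k - h'| <= `|k| + h' by have := ler_normB k h'; rewrite (gtr0_norm h'0).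
  have := H (k + h') ltac:(lra); have := H (k - h') ltac:(lra).
  rewrite !ler_norml => /andP[H1 _] /andP[_ H2].
  have ekp : e * `|k + h'| <= e * (`|k| + h') by rewrite ler_pM2l.
  have ekm : e * `|k - h'| <= e * (`|k| + h') by rewrite ler_pM2l.
  have qh : q * h' <= `|q| * h' by rewrite ler_pM2r// ler_norm.
  have qh' : - (q * h') <= `|q| * h' by rewrite -mulNr ler_pM2r// -normrN ler_norm.
  move: h'eta; rewrite /w mulrDl => h'eta.
  by apply/andP; split; lra.
have AsM : A s = M s.
  have [d d0 /(_ 0)] := As 1 ltr01; rewrite normr0 => /(_ d0).
  by rewrite addr0 !mulr0 subr0 normr_le0 subr_eq0 => /eqP.
split=> //.
have dA : h^-1 *: ((A \o shift s) (h *: 1) - A s) @[h --> 0^'] --> q.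
  apply/cvgrPdist_le => e e0; have [d d0 H] := As e e0.
  apply/nbhs_ballP; exists d => //= k; rewrite /ball /= sub0r normrN => kd k0.
  rewrite /GRing.scale /= mulr1 -(ler_pM2r (_ : 0 < `|k|)) ?normr_gt0//.
  rewrite -normrM mulrBl mulrAC mulVf// mul1r distrC.
  by rewrite (addrC k) AsM; exact: H.
by split; [exact: cvgP dA|exact: cvg_lim dA].
Qed.

Lemma at_right_sub_dnbhs (R : realType) (x : R) : x^'+ `=>` x^'.
Proof.
move=> A; rewrite /dnbhs /at_right /within /=.
by apply: filterS => y Ay y0; apply: Ay; rewrite gt_eqF.
Qed.

Lemma at_left_sub_dnbhs (R : realType) (x : R) : x^'- `=>` x^'.
Proof.
move=> A; rewrite /dnbhs /at_left /within /=.
by apply: filterS => y Ay y0; apply: Ay; rewrite lt_eqF.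
Qed.

Lemma one_sided_limits_derive (R : realType) (f : R -> R) (s p : R) :
  diff_quot f s h @[h --> 0^'+] --> p -> diff_quot f s h @[h --> 0^'-] --> p ->
  is_derive s 1 f p.
Proof.
move=> fp fm.
have H : h^-1 *: ((f \o shift s) (h *: 1) - f s) @[h --> 0^'] --> p.
  have -> : (fun h => h^-1 *: ((f \o shift s) (h *: 1) - f s)) = diff_quot f s.
    by apply/funext => h; rewrite /diff_quot /= /GRing.scale /= mulr1 (addrC h).
  exact: (@cvg_at_right_left_dnbhs _ R^o).
by split; [exact: cvgP H|exact: cvg_lim H].
Qed.

Lemma semiconvex_second_order_ae (R : realType) (c C : R) (f : R -> R) :
  (forall s, 0 <= s <= c -> exists m, forall t, 0 <= t <= c ->
     f s + m * (t - s) - C * (t - s) ^+ 2 <= f t) ->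
  @lebesgue_measure R [set s | 0 <= s <= c /\
    ~ (0 < s < c /\ exists p q, second_order_derivatives f s p q)] = 0%E.
Proof.
move=> Hf; have [c0|c0] := leP c 0.
  apply: (@lebesgue_null_subset _ _ [set 0]) => [s [s0 _]|].
    by rewrite /=; lra.
  exact: lebesgue_measure_set1.
(* Clamping to [[0, c]] makes [M] monotone on the whole line, as [monotone_derivable_ae] asks. *)
pose cl (s : R) := Num.max 0 (Num.min s c).
have cl0 s : 0 <= cl s <= c by rewrite /cl le_max ge_max ge_min !lexx (ltW c0) orbT.
have clE s : 0 <= s <= c -> cl s = s.
  by move=> /andP[s0 sc]; rewrite /cl min_l// max_r.
have cl_nd s t : s <= t -> cl s <= cl t.
  move=> st; rewrite /cl ge_max !le_max lexx /=; apply/orP; right.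
  by rewrite le_min !ge_min st lexx orbT.
have [m Hm] := choice (fun s => Hf (cl s) (cl0 s)).
(* [G] is convex, and [M] is a monotone selection of its subdifferential. *)
pose G t := f t + C * t ^+ 2; pose M t := m (cl t) + 2 * C * cl t.
have GM s t : 0 <= s <= c -> 0 <= t <= c -> G s + M s * (t - s) <= G t.
  move=> s0 t0; have := Hm s t t0; by rewrite /G /M clE//; lra.
have ndM : {homo M : s t / s <= t}.
  move=> s t st; have := cl_nd _ _ st; rewrite le_eqVlt => /orP[/eqP e|lt_cl].
    by rewrite /M e.
  have MclE r : M (cl r) = M r by rewrite /M (clE (cl r)).
  have := GM _ _ (cl0 s) (cl0 t); have := GM _ _ (cl0 t) (cl0 s).
  rewrite !MclE => H1 H2.
  have : (M s - M t) * (cl t - cl s) <= 0 by lra.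
  by rewrite pmulr_lle0; lra.
have near_fG (t : R) (F : set_system R) : Filter F -> F `=>` 0^' ->
    forall l, diff_quot G t h @[h --> F] --> l ->
    diff_quot f t h @[h --> F] --> l - 2 * C * t.
  move=> FF F0 l Gl.
  have Cl : C * (2 * t + h) @[h --> F] --> 2 * C * t.
    rewrite (_ : 2 * C * t = C * (2 * t + 0)); last by ring.
    apply: cvgMr; apply: cvgD; first exact: cvg_cst.
    by apply: (cvg_trans F0); exact: nbhs_dnbhs.
  apply: cvg_trans (cvgB Gl Cl); apply: near_eq_cvg.
  apply: F0; near=> h.
  have h0 : h != 0 by near: h; exact: nbhs_dnbhs_neq.
  by rewrite !fctE /= /diff_quot /G /GRing.scale /=; field.
have rightP t : 0 < t < c -> exists l : R,
    [/\ diff_quot f t h @[h --> 0^'+] --> l - 2 * C * t, M t <= l &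
        forall u, t < u < c -> l <= M u].
  move=> /(subgradient_right GM)[l [Gl Ml lM]]; exists l; split=> //.
  exact: near_fG (@at_right_sub_dnbhs R 0) _ Gl.
have leftP t : 0 < t < c -> exists l : R,
    [/\ diff_quot f t h @[h --> 0^'-] --> l - 2 * C * t, l <= M t &
        forall u, 0 < u < t -> M u <= l].
  move=> /(subgradient_left GM)[l [Gl Ml lM]]; exists l; split=> //.
  exact: near_fG (@at_left_sub_dnbhs R 0) _ Gl.
apply: (@lebesgue_null_subset _ _ ([set x | ~ derivable M x 1] `|` ([set 0] `|` [set c]))); last first.
  apply: lebesgue_null_setU; first exact: monotone_derivable_ae.
  by apply: lebesgue_null_setU; exact: lebesgue_measure_set1.
move=> s [s0c nd]; have [->|s0] := eqVneq s 0; first by right; left.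
have [->|sc] := eqVneq s c; first by right; right.
have {s0c s0 sc} s0c : 0 < s < c.
  by move: s0 sc; rewrite !neq_lt; lra.
left => /= dM; apply: nd; split=> //.
exists (M s - 2 * C * s), ('D_1 M s - 2 * C).
(* On []0, c[], [Ar] and [Al] are the one-sided derivatives of [G]. They satisfy the sandwich
   inequalities with respect to [M]. *)
pose Ar t := right_derivative f t + 2 * C * t.
pose Al t := left_derivative f t + 2 * C * t.
have Mq : is_derive s 1 M ('D_1 M s) by exact: DeriveDef.
have ArP t : 0 < t < c -> M t <= Ar t /\ forall u, t < u < c -> Ar t <= M u.
  move=> /rightP[l [/cvg_lim fl Ml lM]].
  by rewrite /Ar /right_derivative fl// subrK.
have AlP t : 0 < t < c -> Al t <= M t /\ forall u, 0 < u < t -> M u <= Al t.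
  move=> /leftP[l [/cvg_lim fl Ml lM]].
  by rewrite /Al /left_derivative fl// subrK.
have [Ars Arq] : Ar s = M s /\ is_derive s 1 Ar ('D_1 M s).
  apply: (@monotone_sandwich_derive _ c) Mq _ _ => // t u t0 u0 tu.
    by apply: le_trans (ArP t t0).1; apply: ndM; exact: ltW.
  by apply: (ArP t t0).2; lra.
have [Als Alq] : Al s = M s /\ is_derive s 1 Al ('D_1 M s).
  apply: (@monotone_sandwich_derive _ c) Mq _ _ => // t u t0 u0 tu.
    by apply: (AlP t t0).2; lra.
  by apply: le_trans (AlP t t0).1 _; apply: ndM; exact: ltW.
have lin A : is_derive s 1 A ('D_1 M s) ->
    is_derive s 1 (fun t => A t - 2 * C * t) ('D_1 M s - 2 * C).
  move=> dA; have dl : is_derive s 1 ((2 * C) *: (@idfun R)) ((2 * C) *: 1) by exact: is_deriveZ.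
  by have := is_deriveB dA dl; rewrite /GRing.scale /= mulr1.
split.
- apply: one_sided_limits_derive.
    by have [l [fl _ _]] := rightP _ s0c; move: (fl); rewrite -Ars /Ar /right_derivative (cvg_lim _ fl)// subrK.
  by have [l [fl _ _]] := leftP _ s0c; move: (fl); rewrite -Als /Al /left_derivative (cvg_lim _ fl)// subrK.
- near=> t.
  have t0c : 0 < t < c.
    apply/andP; split; near: t; [apply: lt_nbhsr|apply: lt_nbhsl]; lra.
  have [l [fl _ _]] := rightP _ t0c; have [k [fk _ _]] := leftP _ t0c.
  by split; [exact: cvgP fl|exact: cvgP fk].
- by have := lin _ Arq; congr is_derive; apply/funext => t; rewrite /Ar addrK.
- by have := lin _ Alq; congr is_derive; apply/funext => t; rewrite /Al addrK.
Unshelve. all: by end_near. Qed.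

(** * Sets of vanishing one-dimensional Hausdorff measure *)

(* All subsets of [dplane R] are measurable, so that the outer measure
   construction of the library applies to [ediam]. *)
Definition dplane (R : realType) : Type := plane R.
HB.instance Definition _ (R : realType) := Pointed.on (dplane R).
HB.instance Definition _ (R : realType) :=
  @isMeasurable.Build default_measure_display (dplane R)
    (@discrete_measurable _) (@discrete_measurable0 _)
    (@discrete_measurableC _) (@discrete_measurableU _).

Section HausdorffNull.
Variable R : realType.
Implicit Types A : set (plane R).
Local Open Scope ereal_scope.

(** This is $\mathcal{H}^1_\infty$: the covering sets are of arbitrary size, so that countable
    subadditivity is that of a single outer measure. *)
Definition hausdorff1_content A : \bar R :=
  mu_ext (@ediam R : set (dplane R) -> \bar R) A.

Lemma ediam_ge0 A : 0 <= ediam A.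
Proof. by apply: ereal_sup_ubound; left. Qed.

Lemma ediam0 : ediam (set0 : set (plane R)) = 0.
Proof.
apply/eqP; rewrite eq_le ediam_ge0 andbT.
by apply: ge_ereal_sup => _ [->|[p [[]]]].
Qed.

Lemma ediam_le A (d : R) : (0 <= d)%R ->
  (forall a b, A a -> A b -> (enorm (a - b) <= d)%R) -> ediam A <= d%:E.
Proof.
move=> d0 H; apply: ge_ereal_sup => _ [->|[[a b] [/= Aa Ab] <-]]; rewrite lee_fin//.
exact: H.
Qed.

Lemma content_null_subset A B :
  A `<=` B -> hausdorff1_content B = 0 -> hausdorff1_content A = 0.
Proof.
move=> AB B0; apply/eqP; rewrite eq_le mu_ext_ge0 ?andbT; last exact: ediam_ge0.
by rewrite -B0; exact: le_mu_ext.
Qed.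

Lemma content_null_bigcup (I : countType) (F : I -> set (plane R)) :
  (forall i, hausdorff1_content (F i) = 0) ->
  hausdorff1_content (\bigcup_i F i) = 0.
Proof.
move=> F0.
apply: (@content_null_subset _
  (\bigcup_n if unpickle n is Some i then F i else set0)).
  by move=> x [i _ Fix]; exists (pickle i) => //; rewrite pickleK.
apply/eqP; rewrite eq_le mu_ext_ge0 ?andbT; last exact: ediam_ge0.
apply: (le_trans (@mu_ext_sigma_subadditive _ (dplane R) R _ ediam_ge0 _)).
rewrite eseries0// => n _ _; case: unpickle => [i|]; first exact: F0.
exact: (@mu_ext0 _ (dplane R) R _ ediam0 ediam_ge0).
Qed.

Lemma content_nullP A : hausdorff1_content A = 0 ->
  forall d : R, (0 < d)%R -> exists2 U : (set (plane R))^nat,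
    A `<=` \bigcup_k U k & \sum_(0 <= k <oo) ediam (U k) <= d%:E.
Proof.
move=> A0 d d0.
have : hausdorff1_content A \is a fin_num by rewrite A0.
move=> /lb_ereal_inf_adherent-/(_ _ d0)[_ [U [mU AU] <-]].
by rewrite -/(mu_ext _ _) -/(hausdorff1_content A) A0 add0e => /ltW; exists U.
Qed.

(** If the diameters of a cover sum to at most [d], each of them is at most [d]. Covers of small
    total diameter are thus admissible at every scale. *)
Lemma hausdorff1_null A : hausdorff1_content A = 0 -> hausdorff1 A = 0.
Proof.
move=> A0; apply/eqP; rewrite eq_le; apply/andP; split; last first.
  apply: (@le_trans _ _ (hausdorff1_pre 1 A)).
    by apply: le_ereal_inf_tmp => _ [U _ <-]; apply: nneseries_ge0 => *; exact: ediam_ge0.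
  by apply: ereal_sup_ubound; exists 1%R => //=.
apply: ge_ereal_sup => _ [d /= d0 <-].
apply/lee_addgt0Pr => e e0; rewrite add0e.
have m0 : (0 < Num.min d e)%R by rewrite lt_min d0.
have [U AU Ud] := content_nullP A0 m0.
apply: (@le_trans _ _ (\sum_(0 <= k <oo) ediam (U k))); last first.
  by apply: (le_trans Ud); rewrite lee_fin ge_min lexx orbT.
apply: ereal_inf_lbound; exists U => //; split=> // k.
apply: (@le_trans _ _ (\sum_(0 <= k <oo) ediam (U k))); last first.
  by apply: (le_trans Ud); rewrite lee_fin ge_min lexx.
apply: le_trans (nneseries_lim_ge k.+1 _) => [|n _ _]; last exact: ediam_ge0.
by rewrite big_nat_recr//= leeDr// sume_ge0// => n _; exact: ediam_ge0.
Qed.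

Lemma content_null_lipschitz (g : R -> plane R) (L : R) (N : set R) :
  (0 < L)%R -> (forall s t, N s -> N t -> (enorm (g s - g t) <= L * `|s - t|)%R) ->
  @lebesgue_measure R N = 0 -> hausdorff1_content (g @` N) = 0.
Proof.
move=> L0 Lg N0; apply/eqP; rewrite eq_le mu_ext_ge0 ?andbT; last exact: ediam_ge0.
apply/lee_addgt0Pr => e e0; rewrite add0e.
have eL0 : (0 < e / L)%R by rewrite divr_gt0.
have : lebesgue_measure N \is a fin_num by rewrite N0.
move=> /lb_ereal_inf_adherent-/(_ _ eL0)[_ [U [mU NU] <-]] Ue.
have {}Ue : \sum_(k <oo) wlength idfun (U k) <= (e / L)%:E.
  by apply: (le_trans (ltW Ue)); rewrite -[leRHS]add0e leeD2r// -[leRHS]N0.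
apply: (@le_trans _ _ (\sum_(0 <= k <oo) ediam (g @` (U k `&` N)))).
  (* The intervals are cut down to [N] because the Lipschitz bound is available only there. *)
  apply: ereal_inf_lbound; exists (fun k => g @` (U k `&` N)) => //; split=> //.
  by move=> _ [s Ns <-]; have [k _ Uks] := NU _ Ns; exists k => //; exists s.
apply: (@le_trans _ _ (\sum_(0 <= k <oo) (L%:E * wlength idfun (U k)))).
  apply: lee_nneseries => [k _ _|k _]; first exact: ediam_ge0.
  have /ocitvP[->|[[a b] /= ab ->]] : ocitv (U k) by exact: mU.
    by rewrite set0I image_set0 ediam0 wlength0 mule0.
  rewrite wlength_itv_bnd; last exact: ltW.
  rewrite -EFinM; apply: ediam_le.
    by rewrite mulr_ge0// ?subr_ge0 ltW.
  move=> _ _ [s [/= + Ns] <-] [t [/= + Nt] <-]; rewrite !in_itv /= => sab tab.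
  apply: (le_trans (Lg _ _ Ns Nt)); rewrite ler_pM2l// ler_norml; lra.
rewrite nneseriesZl; last by move=> k _; exact: wlength_ge0.
by rewrite muleC -lee_pdivlMr.
Qed.

End HausdorffNull.

(** * Euclidean geometry of the plane *)

Section PlaneGeometry.
Variable R : realType.
Implicit Types (u v w x y z : plane R) (r e : R).

Lemma dotE u v : dot u v = u 0 0 * v 0 0 + u 0 1 * v 0 1.
Proof. by rewrite /dot !big_ord_recl big_ord0 addr0; congr (_ + u _ _ * v _ _); apply/val_inj. Qed.

Lemma ord2E (i : 'I_2) : i = 0 \/ i = 1.
Proof. by case: i => [[|[|//]] i]; [left|right]; exact: val_inj. Qed.

Lemma plane_eqP u v : u 0 0 = v 0 0 -> u 0 1 = v 0 1 -> u = v.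
Proof.
by move=> u0 u1; apply/rowP => i; case: (ord2E i) => ->.
Qed.

Lemma dotC u v : dot u v = dot v u.
Proof. by rewrite !dotE; ring. Qed.

Lemma dotDl u v w : dot (u + v) w = dot u w + dot v w.
Proof. by rewrite !dotE !mxE; ring. Qed.

Lemma dotNl u w : dot (- u) w = - dot u w.
Proof. by rewrite !dotE !mxE; ring. Qed.

Lemma dotZl (a : R) u w : dot (a *: u) w = a * dot u w.
Proof. by rewrite !dotE !mxE; ring. Qed.

Lemma dotDr u v w : dot w (u + v) = dot w u + dot w v.
Proof. by rewrite !dotE !mxE; ring. Qed.

Lemma dotNr u w : dot w (- u) = - dot w u.
Proof. by rewrite !dotE !mxE; ring. Qed.

Lemma dotZr (a : R) u w : dot w (a *: u) = a * dot w u.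
Proof. by rewrite !dotE !mxE; ring. Qed.

Definition dot_lin := (dotDl, dotDr, dotNl, dotNr, dotZl, dotZr).

Lemma dot_ge0 u : 0 <= dot u u.
Proof. by rewrite dotE addr_ge0 // -expr2 sqr_ge0. Qed.

Lemma enorm_ge0 u : 0 <= enorm u.
Proof. exact: sqrtr_ge0. Qed.

Lemma sqr_enorm u : enorm u ^+ 2 = dot u u.
Proof. exact/sqr_sqrtr/dot_ge0. Qed.

Lemma enormN u : enorm (- u) = enorm u.
Proof. by rewrite /enorm dotNl dotNr opprK. Qed.

Lemma enorm_distC u v : enorm (u - v) = enorm (v - u).
Proof. by rewrite -enormN opprB. Qed.

Lemma enormZ (a : R) u : enorm (a *: u) = `|a| * enorm u.
Proof. by rewrite /enorm dotZl dotZr mulrA -expr2 sqrtrM ?sqr_ge0// sqrtr_sqr. Qed.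

Lemma enorm_eq0 u : (enorm u == 0) = (u == 0).
Proof.
rewrite sqrtr_eq0 le_eqVlt ltNge dot_ge0 orbF dotE -!expr2 paddr_eq0 ?sqr_ge0//.
rewrite !sqrf_eq0; apply/andP/eqP => [[/eqP u0 /eqP u1]|->]; last by rewrite !mxE.
by apply: plane_eqP; rewrite mxE.
Qed.

Lemma enorm0 : enorm (0 : plane R) = 0.
Proof. by apply/eqP; rewrite enorm_eq0. Qed.

Lemma enorm_unit v : dot v v = 1 -> enorm v = 1.
Proof. by rewrite /enorm => ->; exact: sqrtr1. Qed.

Lemma enorm_gt0 u : (0 < enorm u) = (u != 0).
Proof. by rewrite lt_neqAle enorm_ge0 andbT eq_sym enorm_eq0. Qed.

Lemma enorm_le u r : 0 <= r -> (enorm u <= r) = (dot u u <= r ^+ 2).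
Proof. by move=> r0; rewrite -sqr_enorm ler_pXn2r// nnegrE enorm_ge0. Qed.

Lemma le_enorm u r : 0 <= r -> (r <= enorm u) = (r ^+ 2 <= dot u u).
Proof. by move=> r0; rewrite -sqr_enorm ler_pXn2r// nnegrE enorm_ge0. Qed.

Lemma cauchy_schwarz u v : `|dot u v| <= enorm u * enorm v.
Proof.
rewrite -(ler_pXn2r (ltn0Sn 1)) ?nnegrE ?mulr_ge0 ?enorm_ge0//.
rewrite exprMn !sqr_enorm -normrX ger0_norm ?sqr_ge0// !dotE -subr_ge0.
rewrite (_ : _ - _ = (u 0 0 * v 0 1 - u 0 1 * v 0 0) ^+ 2) ?sqr_ge0//.
ring.
Qed.

Lemma ler_enormD u v : enorm (u + v) <= enorm u + enorm v.
Proof.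
rewrite enorm_le ?addr_ge0 ?enorm_ge0// sqrrD !sqr_enorm !dot_lin (dotC v u).
have := cauchy_schwarz u v; have := ler_norm (dot u v); lra.
Qed.

Lemma ler_enorm_dist x y z : enorm (x - z) <= enorm (x - y) + enorm (y - z).
Proof. by rewrite -(subrKA y x); exact: ler_enormD. Qed.

Lemma ler_norm_coord u i : `|u 0 i| <= enorm u.
Proof.
rewrite -sqrtr_sqr /enorm ler_wsqrtr//.
by rewrite dotE -!expr2; case: (ord2E i) => ->; rewrite ?lerDl ?lerDr sqr_ge0.
Qed.

Lemma cvg_coord (T : Type) (F : set_system T) {FF : Filter F} (f : T -> plane R) (a : plane R) i :
  f @ F --> a -> (fun t => f t 0 i) @ F --> a 0 i.
Proof.
move=> fa; have ca : {for a, continuous (fun u : plane R => u 0 i)} by exact: coord_continuous.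
exact: (@continuous_cvg _ _ _ F FF f (fun u : plane R => u 0 i) a ca fa).
Qed.

Lemma cvg_dot (T : Type) (F : set_system T) {FF : Filter F} (f g : T -> plane R) (a b : plane R) :
  f @ F --> a -> g @ F --> b -> (fun t => dot (f t) (g t)) @ F --> dot a b.
Proof.
move=> fa gb.
rewrite dotE (_ : (fun t => _) = fun t => f t 0 0 * g t 0 0 + f t 0 1 * g t 0 1).
  by apply: cvgD; apply: cvgM; exact: cvg_coord.
by apply/funext => t; rewrite dotE.
Qed.

Lemma cvg_enorm (T : Type) (F : set_system T) {FF : Filter F} (f : T -> plane R) (a : plane R) :
  f @ F --> a -> (fun t => enorm (f t)) @ F --> enorm a.
Proof.
move=> fa; have sa : {for (dot a a), continuous (@Num.sqrt R)} by exact: sqrt_continuous.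
exact: (@continuous_cvg _ _ _ F FF (fun t => dot (f t) (f t)) (@Num.sqrt R) _ sa (cvg_dot _ _)).
Qed.

Lemma cvg_subr (x z : plane R) : (fun u => u - x) @ z --> z - x.
Proof.
apply: (@cvgB _ _ _ (nbhs z) (nbhs_filter z) (fun u : plane R => u) (fun=> x)).
  by move=> A.
exact: (@cvg_cst _ x _ (nbhs z) (nbhs_filter z)).
Qed.

Lemma continuous_enorm_subr x : continuous (fun z => enorm (z - x)).
Proof. by move=> z; exact: (@cvg_enorm _ (nbhs z) (nbhs_filter z) _ _ (@cvg_subr x z)). Qed.

Lemma continuous_dot_subr x v : continuous (fun z => dot (z - x) v).
Proof.
move=> z; apply: (@cvg_dot _ (nbhs z) (nbhs_filter z) _ _ _ _ (@cvg_subr x z)).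
exact: (@cvg_cst _ v _ (nbhs z) (nbhs_filter z)).
Qed.

Lemma nbhs_eball x r : 0 < r -> nbhs x (eball x r).
Proof.
move=> r0; have /cvgr_lt := @continuous_enorm_subr x x.
by apply; rewrite subrr enorm0.
Qed.

(** The bridge between the sup-norm topology and Euclidean balls: a coordinate is bounded by the
    Euclidean norm, and the latter is continuous. *)
Lemma nbhs_eballP x (A : set (plane R)) :
  nbhs x A <-> exists2 r, 0 < r & eball x r `<=` A.
Proof.
split=> [/nbhs_ballP[r /= r0 rA]|[r r0 rA]]; last by apply: filterS rA _; exact: nbhs_eball.
exists r => // z zr; apply: rA; split=> // i j; rewrite /ball /= (ord1 i).
rewrite distrC; apply: le_lt_trans zr.
by have := ler_norm_coord (z - x) j; rewrite !mxE.
Qed.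

Lemma cvg_planeP (T : Type) (F : set_system T) {FF : Filter F} (f : T -> plane R) (a : plane R) :
  (forall r, 0 < r -> \forall t \near F, enorm (f t - a) < r) -> f @ F --> a.
Proof.
move=> H A /nbhs_eballP[r r0 rA]; apply: filterS (H r r0) => t ft.
exact: rA.
Qed.

Lemma closure_eballP A x : closure A x <-> forall r, 0 < r -> exists2 z, A z & enorm (z - x) < r.
Proof.
split=> [Ax r r0|H B /nbhs_eballP[r r0 rB]].
  by have [z [Az zr]] := Ax _ (nbhs_eball x r0); exists z.
by have [z Az zr] := H r r0; exists z; split=> //; exact: rB.
Qed.

End PlaneGeometry.

Arguments cvg_dot {R T F FF f g a b}.
Arguments cvg_enorm {R T F FF f a}.

Section Frame.
Variables (R : realType) (xi n : plane R).
Hypotheses (xi1 : dot xi xi = 1) (n1 : dot n n = 1) (xin : dot xi n = 0).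

(** The matrix with rows [xi] and [n] has orthonormal rows, hence orthonormal columns; [ad], [bc]
    and [e0] derive the column relations by hand. *)
Lemma frame_decomp (v : plane R) : v = dot v xi *: xi + dot v n *: n.
Proof.
move: xi1 n1 xin; rewrite !dotE.
set a := xi 0 0; set b := xi 0 1; set c := n 0 0; set d := n 0 1 => ab cd abcd.
have ad : a * a = d * d.
  have : a * a * (c * c + d * d) - d * d * (a * a + b * b) = (a * c + b * d) * (a * c - b * d) by ring.
  by rewrite ab cd abcd; lra.
have bc : b * b = c * c by lra.
have e0 : a * b + c * d = 0.
  have -> : a * b + c * d = (a * b + c * d) * (c * c + d * d) by rewrite cd mulr1.
  rewrite (_ : _ * _ = c * (b * (a * c + b * d) + d * (c * c - b * b)) +
    d * (a * (a * c + b * d) + c * (d * d - a * a))); last by ring.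
  by rewrite abcd ad bc; ring.
apply: plane_eqP; rewrite !mxE -/a -/b -/c -/d.
  transitivity (v 0 0 * (a * a + c * c) + v 0 1 * (a * b + c * d)); last by ring.
  by rewrite e0 ad (addrC (d * d)) cd; ring.
transitivity (v 0 1 * (b * b + d * d) + v 0 0 * (a * b + c * d)); last by ring.
by rewrite e0 bc cd; ring.
Qed.

Lemma frame_dot (u v : plane R) : dot u v = dot u xi * dot v xi + dot u n * dot v n.
Proof. by rewrite [in LHS](frame_decomp v) !dot_lin; ring. Qed.

End Frame.

(** * The Frenet equation for a graph over an orthonormal frame *)

Section CurveDerivatives.
Variable R : realType.
Implicit Types (f : R -> R) (xi n z : plane R).

Lemma is_derive_scale_vector (a : R -> R) (s a' : R) (v : plane R) :
  is_derive s 1 a a' -> is_derive s 1 (fun t => a t *: v) (a' *: v).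
Proof.
move=> [da <-].
have H : h^-1 *: (((fun t => a t *: v) \o shift s) (h *: 1) - a s *: v) @[h --> 0^'] --> 'D_1 a s *: v.
  rewrite (_ : (fun h => _) = fun h => (h^-1 *: ((a \o shift s) (h *: 1) - a s)) *: v); last first.
    by apply/funext => h /=; rewrite -scalerBl scalerA.
  exact: cvgZr_tmp da.
by split; [exact: cvgP H|exact: cvg_lim H].
Qed.

Lemma diff_quot_graph f xi n z t (F : set_system R) (l : R) :
  Filter F -> (\forall h \near F, h != 0) -> diff_quot f t h @[h --> F] --> l ->
  diff_quot (fun s => z + s *: xi + f s *: n) t h @[h --> F] --> xi + l *: n.
Proof.
move=> FF F0 fl.
have : xi + diff_quot f t h *: n @[h --> F] --> xi + l *: n.
  by apply: cvgD; [exact: cvg_cst|exact: cvgZr_tmp].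
apply: cvg_trans; apply: near_eq_cvg; near=> h.
have h0 : h != 0 by near: h.
rewrite /diff_quot [_ *: (f _ - _)]/GRing.scale /= -scalerA -[in LHS](scale1r xi) -(mulVf h0) -scalerA -scalerDr.
congr (_ *: _); rewrite scalerBl scalerDl opprD; apply/rowP => i; rewrite !mxE; ring.
Unshelve. all: by end_near. Qed.

Lemma one_sided_graph f xi n z t : one_sided_derivable f t ->
  let c s := z + s *: xi + f s *: n in
  [/\ one_sided_derivable c t,
      right_derivative c t = xi + right_derivative f t *: n &
      left_derivative c t = xi + left_derivative f t *: n].
Proof.
move=> [fr fl] c.
have r0 : \forall h \near (0 : R)^'+, h != 0 by exact: nbhs_right_neq.
have l0 : \forall h \near (0 : R)^'-, h != 0 by exact: nbhs_left_neq.
have cr := @diff_quot_graph f xi n z t _ _ (at_right_proper_filter 0) r0 fr.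
have cl := @diff_quot_graph f xi n z t _ _ (at_left_proper_filter 0) l0 fl.
split; [|apply: (cvg_lim _ cr); exact: norm_hausdorff|apply: (cvg_lim _ cl); exact: norm_hausdorff].
by split; [exact: cvgP cr|exact: cvgP cl].
Qed.

(** With [S] the norm of [xi + D n], the derivatives of [1 / S] and [D / S] at [s] are $-pq/S^3$ and
    $q/S^3$. The common factor is the curvature, and [n - p *: xi] is the quarter turn of
    [xi + p *: n]. [D] will be either one-sided derivative. *)
Lemma is_derive_unit_tangent (D : R -> R) (s p q : R) xi n :
  dot xi xi = 1 -> dot n n = 1 -> dot xi n = 0 ->
  D s = p -> is_derive s 1 D q ->
  is_derive s 1 (fun t => unit_vec (xi + D t *: n))
    (q / (1 + p ^+ 2) `^ (3 / 2) *: (n - p *: xi)).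
Proof.
move=> xi1 n1 xin Dp Dq.
pose S t := Num.sqrt (1 + D t ^+ 2).
have S1 t : 0 < 1 + D t ^+ 2 by rewrite ltr_pwDl// sqr_ge0.
have S0 t : 0 < S t by rewrite sqrtr_gt0.
have SE t : S t ^+ 2 = 1 + D t ^+ 2 by rewrite sqr_sqrtr// ltW.
have unitE t : unit_vec (xi + D t *: n) = (S t)^-1 *: xi + ((S t)^-1 * D t) *: n.
  rewrite /unit_vec (_ : enorm _ = S t); first by rewrite scalerDr scalerA.
  by rewrite /enorm !dot_lin xi1 n1 (dotC n) xin /S; congr Num.sqrt; ring.
have powE : (1 + p ^+ 2) `^ (3 / 2) = S s ^+ 3.
  rewrite -Dp (_ : 3 / 2 = 1 + 2^-1); last by field.
  rewrite powRD; last by rewrite gt_eqF ?implybT.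
  by rewrite powRr1 ?(ltW (S1 s))// powR12_sqrt ?(ltW (S1 s))// -/(S s) -SE; ring.
have dS : is_derive s 1 S ((2 * S s)^-1 * (2 * p * q)).
  have := @is_derive1_comp R (@Num.sqrt R) (fun t => 1 + D t ^+ 2) s _ (2 * p * q) (is_derive1_sqrt (S1 s)).
  apply.
  have d2 : is_derive s 1 ((cst 1 : R -> R) + D ^+ 2) (0 + (2%:R * D s ^+ 1) *: q).
    by apply: is_deriveD; exact: is_deriveX.
  by move: d2; rewrite Dp add0r expr1.
have dV : is_derive s 1 (fun t => (S t)^-1) (- (p * q / S s ^+ 3)).
  apply: is_derive_eq (is_deriveV _ dS) _; first by rewrite gt_eqF.
  by rewrite /GRing.scale /=; field; rewrite gt_eqF.
have dVD : is_derive s 1 (fun t => (S t)^-1 * D t) (q / S s ^+ 3).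
  apply: is_derive_eq (is_deriveM dV Dq) _.
  rewrite /GRing.scale /= Dp.
  have -> : q / S s ^+ 3 = q * (S s ^+ 2 - p ^+ 2) / S s ^+ 3.
    by rewrite SE Dp; congr (_ / _); ring.
  by field; rewrite gt_eqF.
rewrite powE.
rewrite (_ : (fun t => _) = (fun t => (S t)^-1 *: xi) + (fun t => ((S t)^-1 * D t) *: n)); last first.
  by apply/funext => t; rewrite unitE.
apply: is_derive_eq (is_deriveD (is_derive_scale_vector xi dV) (is_derive_scale_vector n dVD)) _.
by apply/rowP => i; rewrite !mxE; ring.
Qed.

Lemma signed_curvature_graph f xi n z (s p q : R) :
  dot xi xi = 1 -> dot n n = 1 -> dot xi n = 0 ->
  second_order_derivatives f s p q ->
  is_signed_curvature xi n (fun t => z + t *: xi + f t *: n) s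
    (q / (1 + p ^+ 2) `^ (3 / 2)).
Proof.
move=> xi1 n1 xin [dp os dr dl]; set c := fun t => _.
have tangent : quarter_turn xi n (xi + p *: n) = n - p *: xi.
  by rewrite /quarter_turn !dot_lin xi1 n1 xin (dotC n) xin !mulr0 mulr1 addr0 add0r scale1r.
have oss : one_sided_derivable f s by exact: nbhs_singleton os.
have fq : diff_quot f s h @[h --> 0^'] --> p.
  have <- : (fun h => h^-1 *: ((f \o shift s) (h *: 1) - f s)) = diff_quot f s.
    by apply/funext => h; rewrite /diff_quot /= /GRing.scale /= mulr1 (addrC h).
  by case: dp => dp <-; exact: dp.
have rp : right_derivative f s = p.
  by apply: cvg_lim => //; apply: cvg_trans fq; move=> A /= /at_right_sub_dnbhs.
have lp : left_derivative f s = p.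
  by apply: cvg_lim => //; apply: cvg_trans fq; move=> A /= /at_left_sub_dnbhs.
exists (xi + p *: n); rewrite tangent; split.
- split.
    apply/eqP => /(congr1 (dot xi)); rewrite !dot_lin xi1 xin mulr0 addr0.
    by rewrite dotE !mxE !mulr0 addr0 => /eqP; rewrite oner_eq0.
  have H : h^-1 *: ((c \o shift s) (h *: 1) - c s) @[h --> 0^'] --> xi + p *: n.
    have -> : (fun h => h^-1 *: ((c \o shift s) (h *: 1) - c s)) = diff_quot c s.
      by apply/funext => h; rewrite /diff_quot /= [h *: 1]/GRing.scale /= mulr1 (addrC h).
    by apply: diff_quot_graph => //; exact: nbhs_dnbhs_neq.
  by split; [exact: cvgP H|exact: cvg_lim H].
- by apply: filterS os => t ost; have [] := one_sided_graph xi n z ost.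
- have := is_derive_unit_tangent xi1 n1 xin rp dr.
  apply: near_eq_is_derive; apply: filterS os => t ost.
  by have [_ -> _] := one_sided_graph xi n z ost.
- have := is_derive_unit_tangent xi1 n1 xin lp dl.
  apply: near_eq_is_derive; apply: filterS os => t ost.
  by have [_ _ ->] := one_sided_graph xi n z ost.
Qed.

End CurveDerivatives.

(** * The boundary of the neighbourhood *)

Section NbhdBoundary.
Variables (R : realType) (E : set (plane R)) (eps : R).
Hypotheses (cE : compact E) (eps_gt0 : 0 < eps).
Implicit Types (x y z p q : plane R).

Lemma nearest_point (K : set (plane R)) x : compact K -> K !=set0 ->
  exists2 q, K q & forall p, K p -> enorm (x - q) <= enorm (x - p).
Proof.
move=> cK K0.
have [|q /set_mem Kq Hq] := @EVT_min_rV R 2 (fun q => enorm (q - x)) K K0 cK.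
  by apply: continuous_subspaceT; exact: continuous_enorm_subr.
by exists q => // p Kp; rewrite ![enorm (x - _)]enorm_distC; apply: Hq; rewrite inE.
Qed.

Lemma edist_leP (K : set (plane R)) x (r : R) : compact K -> K !=set0 ->
  Defs.edist x K <= r <-> exists2 q, K q & enorm (x - q) <= r.
Proof.
move=> cK K0; have lb : has_lbound [set enorm (x - q) | q in K].
  by exists 0; move=> _ [q _ <-]; exact: enorm_ge0.
split=> [xr|[q Kq]]; last by apply: le_trans; apply: ge_inf => //; exists q.
have [q Kq Hq] := nearest_point x cK K0; exists q => //; apply: le_trans xr.
apply: lb_le_inf; first by exists (enorm (x - q)), q.
by move=> _ [p Kp <-]; exact: Hq.
Qed.

(** Moving [x] slightly towards [p] enters the open ball. Together with [nbhd_eps_contrib] this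
    identifies $E_\varepsilon$ with the set of points at distance at most $\varepsilon$ from $E$,
    when $E$ is compact. *)
Lemma nbhd_eps_le x p : E p -> enorm (x - p) <= eps -> nbhd_eps E eps x.
Proof.
move=> Ep xp; apply/closure_eballP => r r0.
pose t := Num.min 1 (r / (2 * eps)).
have t0 : 0 < t by rewrite lt_min ltr01 divr_gt0// mulr_gt0.
have t1 : t <= 1 by rewrite ge_min lexx.
have tr : t * eps <= r / 2.
  rewrite -ler_pdivlMr// (_ : r / 2 / eps = r / (2 * eps)) ?ge_min ?lexx ?orbT//.
  by field; rewrite gt_eqF.
exists (x + t *: (p - x)).
- exists p => //; rewrite /eball /=.
  rewrite (_ : _ - p = (1 - t) *: (x - p)); last first.
    by apply/rowP => i; rewrite !mxE; ring.
  rewrite enormZ ger0_norm ?subr_ge0//.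
  apply: (@le_lt_trans _ _ ((1 - t) * eps)); first by rewrite ler_wpM2l// subr_ge0.
  by rewrite gtr_pMl//; lra.
- rewrite addrC addKr enormZ gtr0_norm// enorm_distC.
  have : t * enorm (x - p) <= t * eps by rewrite ler_wpM2l// ltW.
  lra.
Qed.

Lemma nbhd_eps_contrib x : nbhd_eps E eps x -> exists2 p, E p & enorm (x - p) <= eps.
Proof.
move=> /closure_eballP H; have [z [p0 Ep0 _] _] := H 1 ltr01.
have [p Ep Hp] := @nearest_point E x cE (ex_intro _ p0 Ep0).
exists p => //; apply/ler_addgt0Pr => r /H [u [q Eq]]; rewrite /eball /= => uq ux.
have := Hp _ Eq; have := ler_enorm_dist x u q; rewrite (enorm_distC x u); lra.
Qed.

Notation B := (boundary (nbhd_eps E eps)).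

Lemma boundary_far x p : B x -> E p -> eps <= enorm (x - p).
Proof.
move=> [_ nix] Ep; rewrite leNgt; apply/negP => xp; apply: nix.
apply/nbhs_eballP; exists (eps - enorm (x - p)); first by rewrite subr_gt0.
move=> u; rewrite /eball /= => ux; apply: (@nbhd_eps_le _ p) => //.
by have := ler_enorm_dist u x p; lra.
Qed.

Lemma boundary_contrib x : B x -> exists2 p, E p & enorm (x - p) = eps.
Proof.
move=> Bx; have : nbhd_eps E eps x.
  by case: Bx; rewrite /nbhd_eps -(iffLR (closure_id _))//; exact: closed_closure.
move=> /nbhd_eps_contrib[p Ep xp]; exists p => //.
by apply/eqP; rewrite eq_le xp boundary_far.
Qed.

Lemma boundary_approx x (r : R) : B x -> 0 < r ->
  exists2 u, ~ nbhd_eps E eps u & enorm (u - x) < r.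
Proof.
move=> [_ nix] r0; apply: contrapT => H; apply: nix.
apply/nbhs_eballP; exists r => // u ux; apply: contrapT => Eu; apply: H.
by exists u.
Qed.

Lemma closed_boundary : closed B.
Proof.
apply: closedI; first exact: closed_closure.
by apply: open_closedC; exact: open_interior.
Qed.

(** The point to check is that [y] is not interior to [E]: otherwise a small move from [y] towards
    [z] would stay in [E] and come closer than [eps] to [z]. *)
Lemma boundary_contributors z y : B z -> E y -> enorm (z - y) = eps ->
  contributors E eps z y.
Proof.
move=> Bz Ey zy; split; last by rewrite enorm_distC.
split; first exact: subset_closure.
move=> /nbhs_eballP[r r0 rE].
pose t := Num.min 1 (r / (2 * eps)).
have t0 : 0 < t by rewrite lt_min ltr01 divr_gt0// mulr_gt0.
have t1 : t <= 1 by rewrite ge_min lexx.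
have tr : t * eps <= r / 2.
  rewrite -ler_pdivlMr// (_ : r / 2 / eps = r / (2 * eps)) ?ge_min ?lexx ?orbT//.
  by field; rewrite gt_eqF.
have Eq : E (y + t *: (z - y)).
  by apply: rE; rewrite /eball /= addrC addKr enormZ zy gtr0_norm//; lra.
have := boundary_far Bz Eq.
rewrite (_ : z - _ = (1 - t) *: (z - y)); last by apply/rowP => i; rewrite !mxE; ring.
rewrite enormZ zy ger0_norm ?subr_ge0// => H.
by have : 0 < t * eps by [rewrite mulr_gt0]; lra.
Qed.

Lemma extremal_pairP z xi y : extremal_pairs E eps z (xi, y) ->
  [/\ dot xi xi = 1, E y, enorm (z - y) = eps & dot (z - y) xi = 0].
Proof.
move=> [/= [xi1 _] [By yz] yxi]; split.
- by rewrite -sqr_enorm xi1 expr1n.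
- case: By => + _; rewrite -(iffLR (closure_id _))//.
  by apply: compact_closed => //; exact: norm_hausdorff.
- by rewrite enorm_distC.
- by rewrite -opprB dotNl yxi oppr0.
Qed.

End NbhdBoundary.

(* With [U] and [V] as below, [e^2 = u^2 + U^2 = v^2 + V^2], so that
   [V - U + u (v - u) / U = - ((u - v)^2 + (U - V)^2) / (2 U)]. *)
Lemma sqrt_support (R : realType) (e u v : R) : 0 < e -> `|u| <= e / 2 -> `|v| <= e / 2 ->
  let U := Num.sqrt (e ^+ 2 - u ^+ 2) in let V := Num.sqrt (e ^+ 2 - v ^+ 2) in
  `|u / U| <= 1 /\ U - u / U * (v - u) - 2 / e * (v - u) ^+ 2 <= V.
Proof.
move=> e0 /ler_normlP[u1 u2] /ler_normlP[v1 v2] U V.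
have low (w : R) : - w <= e / 2 -> w <= e / 2 -> e / 2 <= Num.sqrt (e ^+ 2 - w ^+ 2).
  move=> w1 w2; rewrite -[leLHS]gtr0_norm; last by lra.
  by rewrite -sqrtr_sqr ler_sqrt; nra.
have Ue := low u u1 u2; have Ve := low v v1 v2; rewrite -/U -/V in Ue Ve.
have UE : U ^+ 2 = e ^+ 2 - u ^+ 2 by rewrite sqr_sqrtr//; nra.
have VE : V ^+ 2 = e ^+ 2 - v ^+ 2 by rewrite sqr_sqrtr//; nra.
have U0 : 0 < U by lra.
clearbody U V; split.
  by rewrite normrM normfV (gtr0_norm U0) ler_pdivrMr// mul1r ler_norml; lra.
(* The arc is 1-Lipschitz, so the second-order defect is at most $(u-v)^2/U$; with $U \ge e/2$ this
   gives the constant $2/e$. *)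
have D2 : (V - U) ^+ 2 <= (u - v) ^+ 2.
  have s0 : 0 < (U + V) ^+ 2 by rewrite exprn_gt0//; lra.
  rewrite -(ler_pM2r s0).
  have -> : (V - U) ^+ 2 * (U + V) ^+ 2 = (u - v) ^+ 2 * (u + v) ^+ 2.
    have VU : (V - U) * (U + V) = (u - v) * (u + v).
      have -> : (V - U) * (U + V) = V ^+ 2 - U ^+ 2 by ring.
      by rewrite UE VE; ring.
    by rewrite -!exprMn VU.
  apply: ler_wpM2l; first exact: sqr_ge0.
  by nra.
rewrite -(ler_pM2l U0).
have -> : U * (U - u / U * (v - u) - 2 / e * (v - u) ^+ 2) =
   U ^+ 2 - u * (v - u) - (2 * U / e) * (v - u) ^+ 2.
  by field; rewrite !gt_eqF.
have Ue1 : 1 <= 2 * U / e by rewrite ler_pdivlMr//; lra.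
have : 1 * (v - u) ^+ 2 <= (2 * U / e) * (v - u) ^+ 2.
  by rewrite ler_wpM2r// sqr_ge0.
by nra.
Qed.

(** * The function [f^{xi, y}] *)

(** The constant is 1 + 1: one from the slope [m], one from the quadratic term, since
    [|t - s| <= eps / 2] gives [2 / eps * (t - s) ^+ 2 <= |t - s|]. *)
Lemma support_lipschitz (R : realType) (eps : R) (f : R -> R) : 0 < eps ->
  (forall s, 0 <= s <= eps / 2 -> exists2 m, `|m| <= 1 &
    forall t, 0 <= t <= eps / 2 ->
      f s + m * (t - s) - 2 / eps * (t - s) ^+ 2 <= f t) ->
  forall s t, 0 <= s <= eps / 2 -> 0 <= t <= eps / 2 ->
  `|f s - f t| <= 2 * `|s - t|.
Proof.
move=> eps_gt0 support s t.
wlog suff : s t / 0 <= s <= eps / 2 -> 0 <= t <= eps / 2 -> f s - f t <= 2 * `|s - t|.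
  move=> H s0 t0; rewrite ler_norml; have := H s t s0 t0; have := H t s t0 s0.
  by rewrite (distrC t); lra.
move=> s0 t0; have [m m1 Hm] := support s s0.
have := Hm t t0.
have h1 : - (m * (t - s)) <= `|s - t|.
  apply: le_trans (ler_norm _) _; rewrite normrN normrM distrC.
  by rewrite ler_piMl.
have h2 : 2 / eps * (t - s) ^+ 2 <= `|s - t|.
  have st : `|s - t| <= eps / 2 by rewrite ler_norml; lra.
  rewrite -real_normK ?num_real// distrC expr2 mulrA.
  rewrite ler_piMl// mulrAC ler_pdivrMr// mul1r.
  by lra.
move: h1 h2; set u := m * _; set v := 2 / eps * _; lra.
Qed.

Section BoundaryFun.
Variables (R : realType) (E : set (plane R)) (eps : R) (z xi y n : plane R).
Hypotheses (cE : compact E) (eps_gt0 : 0 < eps).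
Hypotheses (xi1 : dot xi xi = 1) (Ey : E y) (zy : enorm (z - y) = eps)
  (zyxi : dot (z - y) xi = 0).
Implicit Types (x p q : plane R) (s t : R).

Hypothesis nE : n = eps^-1 *: (z - y).
Let f := boundary_fun E eps z xi y.
Let K := E `&` closure (half_ball (eps / 2) y xi).

Let eps0 : eps != 0. Proof. by rewrite gt_eqF. Qed.

Lemma frame_normal : dot n n = 1.
Proof.
by rewrite nE dotZl dotZr -sqr_enorm zy; field.
Qed.

Lemma frame_orth : dot xi n = 0.
Proof. by rewrite nE dotZr dotC zyxi mulr0. Qed.

Let zyE : z - y = eps *: n. Proof. by rewrite nE scalerA divff// scale1r. Qed.

Lemma sqr_frame (v : plane R) : enorm v ^+ 2 = dot v xi ^+ 2 + dot v n ^+ 2.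
Proof. by rewrite sqr_enorm (frame_dot xi1 frame_normal frame_orth); ring. Qed.

Lemma sqr_dist_frame s t q : enorm (z + s *: xi + t *: n - q) ^+ 2 =
  (s - dot (q - y) xi) ^+ 2 + (eps + t - dot (q - y) n) ^+ 2.
Proof.
have -> : z + s *: xi + t *: n - q = eps *: n + s *: xi + t *: n - (q - y).
  by rewrite -zyE; apply/rowP => i; rewrite !mxE; ring.
rewrite sqr_frame !(dotDl, dotZl, dotNl) xi1 frame_normal frame_orth (dotC n) frame_orth.
by rewrite -!(dotNl, dotDl); congr (_ ^+ 2 + _ ^+ 2); rewrite !dot_lin; ring.
Qed.

Lemma frame_coords x : x = z + dot (x - z) xi *: xi + dot (x - z) n *: n.
Proof. by rewrite -addrA -(frame_decomp xi1 frame_normal frame_orth) addrC subrK. Qed.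

Lemma halfball_closure q : enorm (q - y) < eps / 2 -> 0 <= dot (q - y) xi ->
  closure (half_ball (eps / 2) y xi) q.
Proof.
move=> qy q0; apply/closure_eballP => r r0.
pose t := Num.min (r / 2) ((eps / 2 - enorm (q - y)) / 2).
have t0 : 0 < t by rewrite lt_min; lra.
have tr : t <= r / 2 by rewrite ge_min lexx.
have tq : t <= (eps / 2 - enorm (q - y)) / 2 by rewrite ge_min lexx orbT.
have txi : enorm (t *: xi) = t.
  by rewrite enormZ gtr0_norm// (enorm_unit xi1) mulr1.
exists (q + t *: xi); last by rewrite addrC addKr txi; lra.
rewrite /half_ball /eball /= addrAC; split; last by rewrite dotDl dotZl xi1; lra.
by have := ler_enormD (q - y) (t *: xi); lra.
Qed.

(** For [s] in [[0, eps / 2]] the abscissa of [s] relative to the centre [q] then has modulus at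
    most [eps / 2], which is the range of [sqrt_support]. *)
Lemma Eloc_bounds q : K q -> [/\ 0 <= dot (q - y) xi <= eps / 2,
  `|dot (q - y) n| <= eps / 2 & E q].
Proof.
move=> [Eq /closure_eballP cq].
have n1 := enorm_unit frame_normal.
have xi1' := enorm_unit xi1.
have qy : enorm (q - y) <= eps / 2.
  apply/ler_addgt0Pr => r /cq[u [uy _]]; move: uy; rewrite /eball /=.
  by have := ler_enorm_dist q u y; rewrite (enorm_distC q u); lra.
have := cauchy_schwarz (q - y) n; have := cauchy_schwarz (q - y) xi.
rewrite n1 xi1' !mulr1 => qxi qn; split=> //; last by lra.
apply/andP; split; last by have := ler_norm (dot (q - y) xi); lra.
apply/ler_addgt0Pr => r /cq[u [_ u0] uq].
have := cauchy_schwarz (u - q) xi; rewrite xi1' mulr1.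
have := ler_norm (dot (u - q) xi); rewrite -(subrKA q u) dotDl in u0.
lra.
Qed.

Lemma compact_Eloc : compact K.
Proof. by apply: compact_closedI => //; exact: closed_closure. Qed.

Lemma Eloc_y : K y.
Proof.
split=> //; apply: halfball_closure; rewrite subrr.
  by rewrite enorm0 divr_gt0.
by rewrite dotE !mxE !mul0r addr0.
Qed.

(* The upper half of the circle of radius [eps] centred at [q], as a graph over
   the line through [z] directed by [xi]. *)
Let arc q s := dot (q - y) n - eps + Num.sqrt (eps ^+ 2 - (s - dot (q - y) xi) ^+ 2).

Lemma Eloc_le q s t : K q -> 0 <= s <= eps / 2 ->
  enorm (z + s *: xi + t *: n - q) <= eps -> t <= arc q s.
Proof.
move=> /Eloc_bounds[qa qb _] s0; rewrite enorm_le ?(ltW eps_gt0)// -sqr_enorm sqr_dist_frame.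
set a := dot _ xi in qa *; set b := dot _ n in qb *; rewrite /arc -/a -/b => H.
have : `|eps + t - b| <= Num.sqrt (eps ^+ 2 - (s - a) ^+ 2).
  by rewrite -sqrtr_sqr ler_wsqrtr//; lra.
by have := ler_norm (eps + t - b); lra.
Qed.

Lemma Eloc_arc q s : K q -> 0 <= s <= eps / 2 ->
  enorm (z + s *: xi + arc q s *: n - q) <= eps.
Proof.
move=> /Eloc_bounds[qa qb _] s0; rewrite enorm_le ?(ltW eps_gt0)// -sqr_enorm sqr_dist_frame.
set a := dot _ xi in qa *; set b := dot _ n in qb *; rewrite /arc -/a -/b.
rewrite (_ : eps + (b - eps + _) - b = Num.sqrt (eps ^+ 2 - (s - a) ^+ 2)); last by ring.
by rewrite sqr_sqrtr; [lra|nra].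
Qed.

Let sup_max (S : set R) (m : R) : S m -> ubound S m -> sup S = m.
Proof.
move=> Sm Um; apply/eqP; rewrite eq_le ge_sup//; last by exists m.
by rewrite ub_le_sup//; exists m.
Qed.

Lemma continuous_arc s : continuous (fun q => arc q s).
Proof.
move=> q; pose F := nbhs q; have FF : Filter F := nbhs_filter q.
have cst (c : R) : (fun=> c) @ F --> c by exact: (@cvg_cst _ c _ F FF).
have da : (fun p => s - dot (p - y) xi) @ F --> s - dot (q - y) xi.
  exact: (@cvgB _ _ _ F FF _ _ _ _ (cst s) (@continuous_dot_subr R y xi q)).
have H : (fun p => eps ^+ 2 - (s - dot (p - y) xi) ^+ 2) @ F -->
   eps ^+ 2 - (s - dot (q - y) xi) ^+ 2.
  by apply: (@cvgB _ _ _ F FF _ _ _ _ (cst _)); exact: (@cvgM _ _ F FF _ _ _ _ da da).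
have sq : {for (eps ^+ 2 - (s - dot (q - y) xi) ^+ 2), continuous (@Num.sqrt R)}.
  exact: sqrt_continuous.
apply: (@cvgD _ _ _ F FF _ _ _ _ _ (@continuous_cvg _ _ _ F FF _ _ _ sq H)).
exact: (@cvgB _ _ _ F FF _ _ _ _ (@continuous_dot_subr R y n q) (cst eps)).
Qed.

Lemma boundary_fun_max s : 0 <= s <= eps / 2 -> exists2 q, K q &
  f s = arc q s /\ forall p, K p -> arc p s <= f s.
Proof.
move=> s0; have [|q /set_mem Kq Hq] := @EVT_max_rV R 2 (fun q => arc q s) K (ex_intro _ y Eloc_y) compact_Eloc.
  by apply: continuous_subspaceT; exact: continuous_arc.
have fE : f s = arc q s.
  apply: sup_max => [|t /= /(edist_leP _ _ compact_Eloc (ex_intro _ y Eloc_y))[p Kp Hp]].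
    apply/(edist_leP _ _ compact_Eloc (ex_intro _ y Eloc_y)); rewrite -nE.
    by exists q; [exact: Kq|exact: Eloc_arc].
  rewrite -nE in Hp; apply: (le_trans (Eloc_le Kp s0 Hp)); apply: Hq; exact: mem_set.
by exists q => //; split=> // p Kp; rewrite fE; apply: Hq; exact: mem_set.
Qed.

(** The arc that realises the maximum at [s] stays below [f] and touches it at [s], so its support
    parabola, with [m] the slope of the arc, also serves [f]. *)
Lemma boundary_fun_support s : 0 <= s <= eps / 2 -> exists2 m, `|m| <= 1 &
  forall t, 0 <= t <= eps / 2 ->
    f s + m * (t - s) - 2 / eps * (t - s) ^+ 2 <= f t.
Proof.
move=> s0; have [q Kq [fs _]] := boundary_fun_max s0.
have [qa qb _] := Eloc_bounds Kq.
set a := dot (q - y) xi in qa.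
exists (- ((s - a) / Num.sqrt (eps ^+ 2 - (s - a) ^+ 2))).
  rewrite normrN; have [] // := @sqrt_support R eps (s - a) (s - a) eps_gt0.
  - by rewrite ler_norml; lra.
  - by rewrite ler_norml; lra.
move=> t t0; have [p Kp [_ Hp]] := boundary_fun_max t0.
apply: le_trans (Hp q Kq).
have [||_] := @sqrt_support R eps (s - a) (t - a) eps_gt0.
- by rewrite ler_norml; lra.
- by rewrite ler_norml; lra.
rewrite (_ : t - a - (s - a) = t - s); last by ring.
by rewrite fs /arc -/a mulNr; lra.
Qed.

Lemma boundary_fun_lipschitz s t : 0 <= s <= eps / 2 -> 0 <= t <= eps / 2 ->
  `|f s - f t| <= 2 * `|s - t|.
Proof. exact: (support_lipschitz eps_gt0 boundary_fun_support). Qed.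

Lemma boundary_curve_lipschitz s t : 0 <= s <= eps / 2 -> 0 <= t <= eps / 2 ->
  enorm (boundary_curve E eps z xi y s - boundary_curve E eps z xi y t) <= 3 * `|s - t|.
Proof.
move=> s0 t0; have := boundary_fun_lipschitz s0 t0.
rewrite /boundary_curve -nE -/f; move: (f s) (f t) => u v uv.
rewrite (_ : _ - _ = (s - t) *: xi + (u - v) *: n); last first.
  by apply/rowP => i; rewrite !mxE; ring.
apply: (le_trans (ler_enormD _ _)); rewrite !enormZ.
rewrite (enorm_unit xi1) (enorm_unit frame_normal).
by move: uv; lra.
Qed.

(** The bound [- (eps / 2) <= t] puts [x] above every centre in [K]; a higher point over the same
    [s] is then farther than [eps] from each of these centres. *)
Lemma boundary_fun_eq x s t q : x = z + s *: xi + t *: n ->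
  0 <= s <= eps / 2 -> - (eps / 2) <= t ->
  (forall p, E p -> eps <= enorm (x - p)) -> K q -> enorm (x - q) <= eps ->
  f s = t.
Proof.
move=> xE s0 t0 far Kq xq; apply: sup_max.
  apply/(edist_leP _ _ compact_Eloc (ex_intro _ y Eloc_y)); rewrite -nE -xE.
  by exists q; [exact: Kq|exact: xq].
move=> r /(edist_leP _ _ compact_Eloc (ex_intro _ y Eloc_y))[p Kp].
have [pa pb Ep] := Eloc_bounds Kp; have := far _ Ep.
rewrite -nE le_enorm ?(ltW eps_gt0)// enorm_le ?(ltW eps_gt0)// -!sqr_enorm xE !sqr_dist_frame.
set a := dot _ xi; set b := dot _ n in pb *; move: pb; rewrite ler_norml => pb H1 H2.
have : (eps + r - b) ^+ 2 <= (eps + t - b) ^+ 2 by lra.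
by nra.
Qed.

(** The crux is that [q] lies on the [xi]-side of [y], hence in the set that defines [f]; then
    [boundary_fun_eq] applies. *)
Lemma boundary_fun_rep x q : (forall p, E p -> eps <= enorm (z - p)) ->
  (forall p, E p -> eps <= enorm (x - p)) -> enorm (x - z) < eps / 4 ->
  0 < dot (x - z) xi -> E q -> enorm (q - y) < eps / 4 -> enorm (x - q) = eps ->
  0 <= dot (x - z) xi <= eps / 2 /\ x = boundary_curve E eps z xi y (dot (x - z) xi).
Proof.
move=> zfar xfar xz s0 Eq qy xq.
have n1 := enorm_unit frame_normal.
have xi1' := enorm_unit xi1.
have := cauchy_schwarz (x - z) n; have := cauchy_schwarz (x - z) xi.
have := cauchy_schwarz (q - y) n; have := cauchy_schwarz (q - y) xi.
rewrite n1 xi1' !mulr1 => aq bq sq tq.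
have xE := frame_coords x.
set s := dot (x - z) xi in s0 sq xE *; set t := dot (x - z) n in tq xE.
have s02 : 0 <= s <= eps / 2.
  by move: sq; rewrite ler_norml; lra.
split=> //.
suff fs : f s = t by rewrite /boundary_curve -nE -/f fs.
apply: (@boundary_fun_eq x s t q xE s02) => //.
- by move: tq; rewrite ler_norml; lra.
- split=> //; apply: halfball_closure; first lra.
  have h1 : eps ^+ 2 <= (0 - dot (q - y) xi) ^+ 2 + (eps + 0 - dot (q - y) n) ^+ 2.
    by rewrite -sqr_dist_frame !scale0r !addr0 sqr_enorm -le_enorm ?(ltW eps_gt0)//; exact: zfar.
  have h2 : (s - dot (q - y) xi) ^+ 2 + (eps + t - dot (q - y) n) ^+ 2 = eps ^+ 2.
    by rewrite -sqr_dist_frame -xE xq.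
  have h3 : eps ^+ 2 <= (s - dot (y - y) xi) ^+ 2 + (eps + t - dot (y - y) n) ^+ 2.
    by rewrite -sqr_dist_frame -xE sqr_enorm -le_enorm ?(ltW eps_gt0)//; exact: xfar.
  have dot0 v : dot 0 v = 0 :> R by rewrite dotE !mxE !mul0r addr0.
  rewrite subrr !dot0 !subr0 in h3.
  rewrite leNgt; apply/negP => a0.
  move: bq aq tq; rewrite !ler_norml.
  set a := dot (q - y) xi in h1 h2 a0 *; set b := dot (q - y) n in h1 h2 *.
  move=> bq aq tq.
  have sa : 0 < s * - a by rewrite mulr_gt0//; lra.
  (* Adding [h1] and [h3] and comparing with [h2] gives [s * a + t * b >= 0]. With [a < 0] this
     makes [t] and [b] of equal sign; [b < 0] then contradicts [h2] with [h3], and [b > 0]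
     contradicts [h1] with [h2]. *)
  have tb : 0 < t * b by lra.
  have s2 := sqr_ge0 s; have a2 := sqr_ge0 a.
  have [b0|b0|b0] := ltgtP b 0; last by rewrite b0 mulr0 ltxx in tb.
    have t0 : t < 0 by rewrite -(nmulr_lgt0 _ b0).
    have : 0 <= - b * (2 * eps + 2 * t - b) by rewrite mulr_ge0//; lra.
    by lra.
  have t0 : 0 < t by rewrite -(pmulr_lgt0 _ b0).
  have : 0 <= t * (2 * eps - 2 * b + t) by rewrite mulr_ge0//; lra.
  by lra.
- by rewrite xq.
Qed.
End BoundaryFun.

(** * Local boundary representations *)

Section UnitVec.
Variable R : realType.
Implicit Types v a b : plane R.

Lemma unit_vecK v : enorm v *: unit_vec v = v.
Proof.
rewrite /unit_vec scalerA; have [->|v0] := eqVneq v 0; first by rewrite scaler0.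
by rewrite divff ?scale1r// enorm_eq0.
Qed.

Lemma enorm_unit_vec v : v != 0 -> enorm (unit_vec v) = 1.
Proof.
move=> v0; rewrite /unit_vec enormZ ger0_norm ?invr_ge0 ?enorm_ge0//.
by rewrite mulVf// enorm_eq0.
Qed.

Lemma unit_vec_lipschitz a b : b != 0 ->
  enorm (unit_vec a - unit_vec b) <= 2 * enorm (a - b) / enorm b.
Proof.
move=> b0; have b1 : 0 < enorm b by rewrite enorm_gt0.
rewrite ler_pdivlMr// mulrC -{1}(gtr0_norm b1) -enormZ scalerBr unit_vecK.
rewrite (_ : _ - b = (enorm b - enorm a) *: unit_vec a + (a - b)); last first.
  by rewrite scalerBl unit_vecK addrA subrK.
apply: (le_trans (ler_enormD _ _)); rewrite enormZ.
have u1 : enorm (unit_vec a) <= 1.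
  have [->|a0] := eqVneq a 0; last by rewrite enorm_unit_vec.
  by rewrite /unit_vec scaler0 enorm0.
have : `|enorm b - enorm a| <= enorm (a - b).
  rewrite ler_norml; have := ler_enorm_dist a b 0; have := ler_enorm_dist b a 0.
  by rewrite !subr0 (enorm_distC b); lra.
have := normr_ge0 (enorm b - enorm a); nra.
Qed.

(** The law of cosines, divided by the distance of [x] and [z]. As [x] tends to [z] it turns
    distance comparisons into signs of limiting inner products. *)
Lemma dot_unit_le (x z q : plane R) : enorm (x - q) <= enorm (z - q) ->
  dot (unit_vec (x - z)) (x - q) <= enorm (x - z) / 2.
Proof.
move=> xz.
have [xz0|xz0] := eqVneq (x - z) 0.
  by rewrite /unit_vec xz0 scaler0 enorm0 mul0r dotE !mxE !mul0r addr0.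
have W0 : 0 < enorm (x - z) by rewrite enorm_gt0.
rewrite -(ler_pM2l W0) -dotZl unit_vecK.
have : dot (x - q) (x - q) <= dot (z - q) (z - q).
  by rewrite -!sqr_enorm ler_pXn2r// nnegrE enorm_ge0.
rewrite (_ : z - q = (x - q) - (x - z)); last by apply/rowP => i; rewrite !mxE; ring.
rewrite !(dotDl (x - q)) !(dotDr (x - q)) !dotNl !dotNr -!sqr_enorm (dotC (x - q) (x - z)).
by lra.
Qed.

Lemma compact_unit_circle : compact [set v : plane R | enorm v = 1].
Proof.
have cI : compact [set v : plane R | forall i, `[-1, 1]%classic (v ord0 i)].
  exact: (@rV_compact R 2 (fun=> `[-1, 1]%classic) (fun=> @segment_compact R _ _)).
apply: subclosed_compact cI _.
  have -> : [set v : plane R | enorm v = 1] = (fun v => enorm (v - 0)) @^-1` [set 1].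
    by apply/seteqP; split=> v /=; rewrite subr0.
  apply: (preimage_closed _ (@closed_eq _ _)) => v _.
  exact: continuous_enorm_subr.
move=> v /= v1 i; rewrite /= in_itv /= -ler_norml -v1; exact: ler_norm_coord.
Qed.

End UnitVec.

Section Limit.
Variables (R : realType) (E : set (plane R)) (eps : R).
Hypotheses (cE : compact E) (eps_gt0 : 0 < eps).
Implicit Types (x y z p q w : plane R).
Notation B := (boundary (nbhd_eps E eps)).

Lemma cvg_of_rate (u : nat -> plane R) a (C : R) : 
  (forall k, enorm (u k - a) <= C * k.+1%:R^-1) -> u @ \oo --> a.
Proof.
move=> H; apply: cvg_planeP => r r0.
have C0 : 0 < `|C| + 1 by have := normr_ge0 C; lra.
near=> k; apply: le_lt_trans (H k) _.
have k0 : 0 < k.+1%:R^-1 :> R by rewrite invr_gt0.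
have : k.+1%:R^-1 < r / (`|C| + 1).
  by near: k; apply: near_infty_natSinv_lt (PosNum (divr_gt0 r0 C0)).
rewrite ltr_pdivlMr//; apply: le_lt_trans.
by rewrite mulrC ler_pM2l//; have := ler_norm C; lra.
Unshelve. all: by end_near. Qed.

(** Orthogonality comes from two comparisons: [q] is no closer to [z] than to [x], which gives
    [dot w (z - y) <= 0], and [y] is no closer to [x] than to [z], which gives the reverse
    inequality. *)
Lemma limit_extremal z w y : B z -> E y ->
  (forall d : R, 0 < d -> exists x q, [/\ B x, 0 < enorm (x - z) < d,
     enorm (unit_vec (x - z) - w) < d, E q /\ enorm (q - y) < d & enorm (x - q) = eps]) ->
  extremal_pairs E eps z (w, y).
Proof.
move=> Bz Ey H.
have k0 k : 0 < k.+1%:R^-1 :> R by rewrite invr_gt0.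
have [X HX] := choice (fun k => H _ (k0 k)).
have [Q {}HX] := choice HX.
have W0 k : 0 < enorm (X k - z) by have [_ /andP[]] := HX k.
have Wn0 k : X k - z != 0 by rewrite -enorm_gt0.
have Xz : X @ \oo --> z.
  by apply: (@cvg_of_rate _ _ 1) => k; rewrite mul1r; have [_ /andP[_ /ltW]] := HX k.
have Uw : (fun k => unit_vec (X k - z)) @ \oo --> w.
  by apply: (@cvg_of_rate _ _ 1) => k; rewrite mul1r; have [_ _ /ltW] := HX k.
have Qy : Q @ \oo --> y.
  by apply: (@cvg_of_rate _ _ 1) => k; rewrite mul1r; have [_ _ _ [_ /ltW]] := HX k.
have XQ : (fun k => X k - Q k) @ \oo --> z - y by apply: cvgB.
have W : (fun k => enorm (X k - z)) @ \oo --> (0 : R).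
  by rewrite -(@enorm0 R) -(subrr z); apply: cvg_enorm; apply: cvgB => //; exact: cvg_cst.
have w1 : enorm w = 1.
  have := cvg_enorm (FF := eventually_filter) Uw; rewrite (_ : (fun k => _) = fun=> 1); last first.
    by apply/funext => k; rewrite enorm_unit_vec.
  by move=> /cvg_lim <-//; rewrite lim_cst.
have zy : enorm (z - y) = eps.
  have := cvg_enorm (FF := eventually_filter) XQ; rewrite (_ : (fun k => _) = fun=> eps); last first.
    by apply/funext => k; have [] := HX k.
  by move=> /cvg_lim <-//; rewrite lim_cst.
have up : dot w (z - y) <= 0.
  have D := cvg_dot (FF := eventually_filter) Uw XQ.
  have D0 : (fun k => enorm (X k - z) / 2) @ \oo --> (0 : R).
    by rewrite -(mul0r 2^-1); apply: cvgMl.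
  apply: (ler_cvg_to D D0); near=> k.
  have [_ _ _ [Eq _] xq] := HX k; have := boundary_far eps_gt0 Bz Eq.
  rewrite -{1}xq => zq; apply: dot_unit_le => //.
have low : 0 <= dot w (z - y).
  have D := cvg_dot (FF := eventually_filter) Uw (@cvg_cst _ (z - y) _ \oo eventually_filter).
  have D0 : (fun k => - (enorm (X k - z) / 2)) @ \oo --> (0 : R).
    by rewrite -oppr0 -[in - 0](mul0r 2^-1); apply: cvgN; apply: cvgMl.
  apply: (ler_cvg_to D0 D); near=> k.
  have [Bx _ _ _ _] := HX k; have := boundary_far eps_gt0 Bx Ey.
  rewrite -zy => /dot_unit_le.
  have -> : unit_vec (z - X k) = - unit_vec (X k - z).
    by rewrite /unit_vec enorm_distC -[z - X k]opprB scalerN.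
  by rewrite dotNl enorm_distC; lra.
have dot0 : dot (y - z) w = 0.
  by rewrite -opprB dotNl dotC; apply/eqP; rewrite oppr_eq0 eq_le up.
split=> //=; last exact: boundary_contributors.
split=> //.
(* The boundary points [X k] belong to the neighbourhood, whereas an outward direction needs points
   outside. Perturbing by a small fraction of the distance to [z] leaves the limit direction
   unchanged. *)
have /choice[U HU] k : exists u, ~ nbhd_eps E eps u /\
    enorm (u - X k) < k.+1%:R^-1 * enorm (X k - z).
  have [Bx _ _ _ _] := HX k.
  by have [u ? ?] := boundary_approx Bx (mulr_gt0 (k0 k) (W0 k)); exists u.
have k1 k : k.+1%:R^-1 <= 1 :> R by rewrite invf_le1// ler1n.
have Wk k : enorm (X k - z) < k.+1%:R^-1 by have [_ /andP[]] := HX k.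
exists U; split=> [k||]; first by have [] := HU k.
  apply: (@cvg_of_rate _ _ 2) => k; have [_ Uk] := HU k.
  have := ler_enorm_dist (U k) (X k) z.
  have : k.+1%:R^-1 * enorm (X k - z) <= 1 * enorm (X k - z) by rewrite ler_pM2r.
  by move: (Wk k) Uk; move: k.+1%:R^-1 => e; lra.
apply: (@cvg_of_rate _ _ 3) => k; have [_ Uk] := HU k.
have uw : enorm (unit_vec (X k - z) - w) < k.+1%:R^-1 by have [] := HX k.
have := ler_enorm_dist (unit_vec (U k - z)) (unit_vec (X k - z)) w.
have : enorm (unit_vec (U k - z) - unit_vec (X k - z)) <= 2 * k.+1%:R^-1.
  apply: (le_trans (unit_vec_lipschitz _ (Wn0 k))).
  rewrite ler_pdivrMr// -mulrA ler_pM2l// (_ : _ - _ = U k - X k) ?ltW//.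
  by apply/rowP => i; rewrite !mxE; ring.
by move: uw; move: k.+1%:R^-1 => e; lra.
Unshelve. all: by end_near. Qed.

(* The direction of [x - z] and a contributor of [x] range over the compact set
   [unit circle * E]; near a pair of that set which is not extremal there is no
   such [x] at all. *)
Definition represented z x := exists (pr : plane R * plane R) (s : R),
  [/\ extremal_pairs E eps z pr, 0 <= s <= eps / 2 &
      x = boundary_curve E eps z pr.1 pr.2 s].

Lemma represented_near_pair z w y : B z -> enorm w = 1 -> E y ->
  exists2 d : R, 0 < d & forall x q, B x -> 0 < enorm (x - z) < d ->
    enorm (unit_vec (x - z) - w) < d -> E q -> enorm (q - y) < d ->
    enorm (x - q) = eps -> represented z x.
Proof.
move=> Bz w1 Ey; have [ext|next] := pselect (extremal_pairs E eps z (w, y)).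
  have [ww _ zy zyw] := extremal_pairP cE ext.
  (* A unit vector at distance less than 1 from [w] has positive inner product with [w]; [eps / 4]
     is the range of [boundary_fun_rep]. *)
  exists (Num.min 1 (eps / 4)); first by rewrite lt_min ltr01 divr_gt0.
  move=> x q Bx; rewrite !lt_min => /and3P[x0 _ xz] /andP[uw _] Eq /andP[_ qy] xq.
  have s0 : 0 < dot (x - z) w.
    rewrite -(unit_vecK (x - z)) dotZl mulr_gt0//.
    have := cauchy_schwarz (unit_vec (x - z) - w) w.
    rewrite w1 mulr1 dotDl dotNl ww ler_norml; lra.
  have [s02 xE] := boundary_fun_rep cE eps_gt0 ww Ey zy zyw (erefl _)
    (fun p => boundary_far eps_gt0 Bz) (fun p => boundary_far eps_gt0 Bx) xz s0 Eq qy xq.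
  by exists (w, y), (dot (x - z) w).
have [d d0 Hd] : exists2 d : R, 0 < d & ~ exists x q, [/\ B x, 0 < enorm (x - z) < d,
     enorm (unit_vec (x - z) - w) < d, E q /\ enorm (q - y) < d & enorm (x - q) = eps].
  apply: contrapT => H; apply: next; apply: limit_extremal => // d d0.
  by apply: contrapT => H2; apply: H; exists d.
exists d => // x q Bx xz uw Eq qy xq; exfalso; apply: Hd.
by exists x, q.
Qed.

Lemma boundary_represented z : B z -> exists2 d : R, 0 < d &
  forall x, B x -> 0 < enorm (x - z) < d -> represented z x.
Proof.
move=> Bz.
(* Direction and contributor are prescribed exactly, since the near-covering form of compactness
   supplies the neighbourhoods of the pair and makes [d] uniform. *)
pose P (d : R) (wy : plane R * plane R) := forall x q, B x ->
  0 < enorm (x - z) < d -> unit_vec (x - z) = wy.1 -> q = wy.2 -> E q ->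
  enorm (x - q) = eps -> represented z x.
have : compact ([set v : plane R | enorm v = 1] `*` E).
  by apply: compact_setX => //; exact: compact_unit_circle.
move=> /compact_near_coveringP /(_ R (0 : R)^'+ P).
have cover wy : ([set v : plane R | enorm v = 1] `*` E) wy ->
    \forall wy' \near wy & d \near (0 : R)^'+, P d wy'.
  case: wy => w y [/= w1 Ey]; have [d d0 Hd] := represented_near_pair Bz w1 Ey.
  exists (eball w d `*` eball y d, [set t | t < d]).
    split=> /=; last exact: nbhs_right_lt.
    by exists (eball w d, eball y d) => //; split=> /=; exact: nbhs_eball.
  move=> [[w' y'] t] [/= [ww' yy'] td] x q Bx xz uE qE Eq xq.
  apply: (Hd x q) => //; [lra|by rewrite uE|by rewrite qE].
move=> /(_ _ cover) near0.
have [d [d0 Hd]] : exists d : R, 0 < d /\ ([set v : plane R | enorm v = 1] `*` E) `<=` P d.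
  near (0 : R)^'+ => d; exists d; split; last by near: d.
  by near: d; exact: nbhs_right_gt.
exists d => // x Bx xz; have [q Eq xq] := boundary_contrib cE eps_gt0 Bx.
apply: (Hd (unit_vec (x - z), q) _ x q) => //; split=> //=.
by rewrite enorm_unit_vec// -enorm_gt0; case/andP: xz.
Unshelve. all: by end_near. Qed.

Lemma boundary_curve0 z xi y : B z -> extremal_pairs E eps z (xi, y) ->
  boundary_curve E eps z xi y 0 = z.
Proof.
move=> Bz ext; have [xi1 Ey zy zyxi] := extremal_pairP cE ext.
rewrite /boundary_curve (_ : boundary_fun _ _ _ _ _ _ = 0) ?scale0r ?addr0//.
apply: (@boundary_fun_eq _ _ _ z xi y _ cE eps_gt0 xi1 Ey zy zyxi (erefl _) z 0 0 y).
- by rewrite !scale0r !addr0.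
- by rewrite lexx divr_ge0// ltW.
- by rewrite oppr_le0 divr_ge0// ltW.
- by move=> p; exact: boundary_far.
- exact: Eloc_y.
- by rewrite zy.
Qed.

(** Points outside the neighbourhood are farther from [y] than [z] is, so the directions leading to
    them cannot point towards [y] in the limit. *)
Lemma outward_polar z xi y : enorm (z - y) = eps -> E y ->
  outward_directions E eps z xi -> 0 <= dot xi (z - y).
Proof.
move=> zy Ey [xi1 [u [uE uz uxi]]].
have D := cvg_dot (FF := eventually_filter) uxi (@cvg_cst _ (z - y) _ \oo eventually_filter).
have W : (fun k => enorm (u k - z)) @ \oo --> (0 : R).
  by rewrite -(@enorm0 R) -(subrr z); apply: cvg_enorm; apply: cvgB => //; exact: cvg_cst.
have D0 : (fun k => - (enorm (u k - z) / 2)) @ \oo --> (0 : R).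
  by rewrite -oppr0 -[in - 0](mul0r 2^-1); apply: cvgN; apply: cvgMl.
apply: (ler_cvg_to D0 D); near=> k.
have : enorm (z - y) <= enorm (u k - y).
  rewrite zy leNgt; apply/negP => uy; apply: (uE k).
  exact: (nbhd_eps_le eps_gt0 Ey (ltW uy)).
move=> /dot_unit_le.
have -> : unit_vec (z - u k) = - unit_vec (u k - z).
  by rewrite /unit_vec enorm_distC -[z - u k]opprB scalerN.
by rewrite dotNl enorm_distC; lra.
Unshelve. all: by end_near. Qed.

End Limit.

(** * Finiteness of the set of extremal pairs at a point *)

Section FinitePairs.
Variables (R : realType) (E : set (plane R)) (eps : R).
Hypotheses (cE : compact E) (eps_gt0 : 0 < eps).
Implicit Types (z : plane R) (pr : plane R * plane R).

(** The determinant of [z - y] and [xi]. At an extremal pair it is [eps] or [- eps], according to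
    which quarter turn takes the direction of [z - y] to [xi]. *)
Definition orientation z pr : R :=
  (z - pr.2) 0 0 * pr.1 0 1 - (z - pr.2) 0 1 * pr.1 0 0.

Definition opposite_pair z pr : plane R * plane R := (- pr.1, 2 *: z - pr.2).

Lemma orientation_sqr z pr : extremal_pairs E eps z pr ->
  orientation z pr ^+ 2 = eps ^+ 2.
Proof.
case: pr => xi y /(extremal_pairP cE)[xi1 _ zy zyxi].
transitivity (dot (z - y) (z - y) * dot xi xi - dot (z - y) xi ^+ 2).
  by rewrite !dotE /orientation /=; ring.
by rewrite zyxi xi1 -sqr_enorm zy; ring.
Qed.

Lemma extremal_direction_rot z pr : extremal_pairs E eps z pr ->
  eps ^+ 2 * pr.1 0 0 = - orientation z pr * (z - pr.2) 0 1 /\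
  eps ^+ 2 * pr.1 0 1 = orientation z pr * (z - pr.2) 0 0.
Proof.
case: pr => xi y /(extremal_pairP cE)[xi1 _ zy zyxi].
rewrite -zy sqr_enorm /orientation /=; move: zyxi; rewrite !dotE.
move: (z - y) => v zyxi; split.
  transitivity (- (v 0 0 * xi 0 1 - v 0 1 * xi 0 0) * v 0 1 + v 0 0 * (v 0 0 * xi 0 0 + v 0 1 * xi 0 1)).
    by ring.
  by rewrite zyxi; ring.
transitivity ((v 0 0 * xi 0 1 - v 0 1 * xi 0 0) * v 0 0 + v 0 1 * (v 0 0 * xi 0 0 + v 0 1 * xi 0 1)).
  by ring.
by rewrite zyxi; ring.
Qed.

(* If [xi] and [xi'] are the same quarter turn of [z - y] and [z - y'], then
   [dot xi (z - y') = - dot xi' (z - y)], while both are nonnegative. *)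
Lemma same_orientation z pr pr' : extremal_pairs E eps z pr ->
  extremal_pairs E eps z pr' -> orientation z pr = orientation z pr' ->
  pr' = pr \/ pr' = opposite_pair z pr.
Proof.
case: pr pr' => [xi y] [xi' y'] ext ext' or_eq.
have [a0 a1] := extremal_direction_rot ext; have [a0' a1'] := extremal_direction_rot ext'.
have osq := orientation_sqr ext.
have [xi1 Ey zy zyxi] := extremal_pairP cE ext.
have [xi1' Ey' zy' zyxi'] := extremal_pairP cE ext'.
have [out _ _] := ext; have [out' _ _] := ext'.
have p1 := outward_polar eps_gt0 zy' Ey' out.
have p2 := outward_polar eps_gt0 zy Ey out'.
rewrite -{}or_eq in a0' a1'; move: (orientation _ _) a0 a1 a0' a1' osq => o /= a0 a1 a0' a1' osq.
have e2 : 0 < eps ^+ 2 by rewrite exprn_gt0.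
have e20 : eps ^+ 2 != 0 by rewrite gt_eqF.
have vv : dot (z - y) (z - y) = eps ^+ 2 by rewrite -sqr_enorm zy.
have vv' : dot (z - y') (z - y') = eps ^+ 2 by rewrite -sqr_enorm zy'.
have yE : y = z - (z - y) by rewrite subKr.
have yE' : y' = z - (z - y') by rewrite subKr.
have opp : 2 *: z - y = z + (z - y) by rewrite scaler_nat mulr2n addrA.
rewrite /opposite_pair /= opp; move: p1 p2.
rewrite !dotE in vv vv'; rewrite !dotE.
move: (z - y) (z - y') yE yE' vv vv' a0 a1 a0' a1' => v v' yE yE' vv vv' a0 a1 a0' a1'.
rewrite -(ler_pM2l e2) mulr0 mulrDr !mulrA a0 a1 => p1.
rewrite -(ler_pM2l e2) mulr0 mulrDr !mulrA a0' a1' => p2.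
have oD : o * (v 0 0 * v' 0 1 - v 0 1 * v' 0 0) = 0 by lra.
have D0 : v 0 0 * v' 0 1 - v 0 1 * v' 0 0 = 0.
  apply/eqP; move/eqP: oD; rewrite mulf_eq0 => /orP[/eqP o0|//].
  by move: osq; rewrite o0 expr0n /= => /esym/eqP; rewrite (negbTE e20).
pose c := v 0 0 * v' 0 0 + v 0 1 * v' 0 1.
have v'0 : eps ^+ 2 * v' 0 0 = c * v 0 0.
  transitivity (c * v 0 0 - (v 0 0 * v' 0 1 - v 0 1 * v' 0 0) * v 0 1); last by rewrite D0; ring.
  by rewrite -vv /c; ring.
have v'1 : eps ^+ 2 * v' 0 1 = c * v 0 1.
  transitivity (c * v 0 1 + (v 0 0 * v' 0 1 - v 0 1 * v' 0 0) * v 0 0); last by rewrite D0; ring.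
  by rewrite -vv /c; ring.
have c2 : c ^+ 2 = (eps ^+ 2) ^+ 2.
  transitivity ((v 0 0 * v 0 0 + v 0 1 * v 0 1) * (v' 0 0 * v' 0 0 + v' 0 1 * v' 0 1)
    - (v 0 0 * v' 0 1 - v 0 1 * v' 0 0) ^+ 2); first by rewrite /c; ring.
  by rewrite vv vv' D0; ring.
have /orP[/eqP cE1|/eqP cE1] : (c == eps ^+ 2) || (c == - eps ^+ 2).
  by rewrite -eqf_sqr c2.
- have v'E : v' = v.
    by apply: plane_eqP; apply: (mulfI e20); rewrite ?v'0 ?v'1 cE1.
  left; congr (_, _); last by rewrite yE yE' v'E.
  by apply: plane_eqP; apply: (mulfI e20); rewrite ?a0 ?a1 ?a0' ?a1' v'E.
- have v'E : v' = - v.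
    by apply: plane_eqP; apply: (mulfI e20); rewrite !mxE ?v'0 ?v'1 cE1; ring.
  right; congr (_, _); last by rewrite yE' v'E opprK.
  apply: plane_eqP; apply: (mulfI e20); rewrite !mxE mulrN ?a0 ?a1 ?a0' ?a1' v'E mxE; ring.
Qed.

(** For either orientation there are at most two pairs, one that occurs and its opposite. *)
Lemma extremal_pairs_finite z : exists s : seq (plane R * plane R),
  forall pr, extremal_pairs E eps z pr -> pr \in s.
Proof.
have side o : exists s : seq (plane R * plane R),
    forall pr, extremal_pairs E eps z pr -> orientation z pr = o -> pr \in s.
  have [[pr0 ext0 o0]|no] := pselect (exists2 pr, extremal_pairs E eps z pr & orientation z pr = o).
    exists [:: pr0; opposite_pair z pr0] => pr ext oE.
    have [->|->] := same_orientation ext0 ext (etrans o0 (esym oE)).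
      by rewrite mem_head.
    by rewrite !inE eqxx orbT.
  by exists [::] => pr ext oE; exfalso; apply: no; exists pr.
have [s1 H1] := side eps; have [s2 H2] := side (- eps).
exists (s1 ++ s2) => pr ext; rewrite mem_cat.
have /orP[/eqP oE|/eqP oE] : (orientation z pr == eps) || (orientation z pr == - eps).
  by rewrite -eqf_sqr orientation_sqr.
- by rewrite H1.
- by rewrite H2 ?orbT.
Qed.

Lemma content_null_extremal z (G : plane R * plane R -> set (plane R)) :
  (forall pr, extremal_pairs E eps z pr -> hausdorff1_content (G pr) = 0%E) ->
  hausdorff1_content (\bigcup_(pr in extremal_pairs E eps z) G pr) = 0%E.
Proof.
move=> G0; have [s Hs] := extremal_pairs_finite z.
pose F i := [set x | extremal_pairs E eps z (nth (0, 0) s i) /\ G (nth (0, 0) s i) x].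
apply: (@content_null_subset _ _ (\bigcup_i F i)).
  move=> x [pr ext Gx]; exists (index pr s) => //.
  by rewrite /F /= nth_index//; exact: Hs.
apply: content_null_bigcup => i.
have [ext|next] := pselect (extremal_pairs E eps z (nth (0, 0) s i)).
  by apply: content_null_subset (G0 _ ext) => x [].
apply: (@content_null_subset _ _ set0) => [x [] //|].
exact: (@mu_ext0 _ (dplane R) R _ (@ediam0 R) (@ediam_ge0 R)).
Qed.

End FinitePairs.

(* The cells of the grids [Z^2 / (k + 1)] form a countable base. *)
Lemma content_null_local (R : realType) (A : set (plane R)) :
  (forall z, A z -> exists2 r, 0 < r & hausdorff1_content (A `&` eball z r) = 0%E) ->
  hausdorff1_content A = 0%E.
Proof.
move=> loc.
pose cell (x : plane R) (k : nat) (i : 'I_2) := Num.floor (x 0 i * k.+1%:R).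
pose Q (i : nat * (int * int)) := [set x | cell x i.1 0 = i.2.1 /\ cell x i.1 1 = i.2.2].
pose F i := [set x | hausdorff1_content (A `&` Q i) = 0%E /\ (A `&` Q i) x].
apply: (@content_null_subset _ _ (\bigcup_i F i)); last first.
  apply: content_null_bigcup => i.
  have [n0|n0] := pselect (hausdorff1_content (A `&` Q i) = 0%E).
    by apply: content_null_subset n0 => x [].
  apply: (@content_null_subset _ _ set0) => [x [] //|].
  exact: (@mu_ext0 _ (dplane R) R _ (@ediam0 R) (@ediam_ge0 R)).
move=> x Ax; have [r r0 xr] := loc x Ax.
(* Two points of a cell differ by less than [1 / (k + 1)] in each coordinate, so the cell of [x]
   lies in the ball of radius [2 / (k + 1) < r] around [x]. *)
pose k := Num.truncn (2 / r).
have kr : 2 / k.+1%:R < r.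
  rewrite ltr_pdivrMr ?ltr0n// mulrC -ltr_pdivrMr//; exact: Num.Theory.truncnS_gt.
exists (k, (cell x k 0, cell x k 1)) => //; split=> //.
apply: content_null_subset xr => u [Au [u0 u1]]; split=> //.
have near_coord i : cell u k i = cell x k i -> `|u 0 i - x 0 i| < 1 / k.+1%:R.
  rewrite /cell => cux; rewrite ltr_pdivlMr ?ltr0n// -[X in _ * X]ger0_norm ?ler0n//.
  rewrite -normrM mulrBl.
  have := Num.Theory.floor_itv (u 0 i * k.+1%:R).
  have := Num.Theory.floor_itv (x 0 i * k.+1%:R).
  rewrite cux !intrD ltr_norml; lra.
have := near_coord _ u0; have := near_coord _ u1.
move=> c1 c0; rewrite /eball /=; apply: le_lt_trans kr.
rewrite enorm_le ?divr_ge0// dotE !mxE.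
move: c0 c1; rewrite !ltr_norml; set a := _ - _; set b := _ - _.
rewrite (_ : 2 / k.+1%:R = 2 * (1 / k.+1%:R)); last by rewrite mulrA mulr1.
move: (1 / _) => t; nra.
Qed.

Lemma content_null_set1 (R : realType) (x : plane R) :
  hausdorff1_content [set x] = 0%E.
Proof.
rewrite -(image_set1 (fun=> x) (0 : R)).
apply: (@content_null_lipschitz _ _ 1) => [//|s t _ _|].
  by rewrite subrr enorm0 mul1r.
exact: lebesgue_measure_set1.
Qed.

Section LocalRepresentation.
Variables (R : realType) (E : set (plane R)) (eps : R).
Hypotheses (cE : compact E) (eps_gt0 : 0 < eps).
Notation B := (boundary (nbhd_eps E eps)).

(** The largest admissible parameter set: the inclusion of the curves in the boundary holds by
    construction, and closedness follows from the Lipschitz bound. *)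
Definition curve_domain z r (pr : plane R * plane R) : set R :=
  [set s | 0 <= s <= eps / 2 /\
    (B `&` closure (eball z r)) (boundary_curve E eps z pr.1 pr.2 s)].

Lemma closed_curve_domain z r pr : extremal_pairs E eps z pr ->
  closed (curve_domain z r pr).
Proof.
case: pr => xi y ext; have [xi1 Ey zy zyxi] := extremal_pairP cE ext.
have lip := boundary_curve_lipschitz cE eps_gt0 xi1 Ey zy zyxi (erefl _).
pose S := B `&` closure (eball z r).
have cS : closed S by apply: closedI; [exact: closed_boundary|exact: closed_closure].
move=> s cs; have s0 : 0 <= s <= eps / 2.
  have : closed (`[0, eps / 2]%classic : set R) by exact: interval_closed.
  have /[swap] /[apply] : closure (`[0, eps / 2]%classic : set R) s.
    by move: cs; apply: closureS => t [t0 _]; rewrite /= in_itv.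
  by rewrite /= in_itv.
split=> //; apply: cS; apply/closure_eballP => e e0.
have e3 : 0 < e / 3 by rewrite divr_gt0.
have [t [[t0 St] st]] := cs _ (nbhsx_ballx s _ e3).
exists (boundary_curve E eps z xi y t) => //.
apply: (le_lt_trans (lip _ _ t0 s0)); move: st; rewrite /ball /= distrC.
by lra.
Qed.

Lemma boundary_local_repr z : B z -> extremal_pairs E eps z !=set0 ->
  exists2 r, 0 < r & local_boundary_repr E eps z r (curve_domain z r).
Proof.
move=> Bz [[xi0 y0] ext0]; have [d d0 rep] := boundary_represented cE eps_gt0 Bz.
have e0 : 0 <= eps / 2 by rewrite divr_ge0// ltW.
exists (d / 2); first by rewrite divr_gt0.
split=> [|pr ext|]; first by rewrite divr_gt0.
  split; first exact: closed_curve_domain.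
  by move=> s [s0 _]; rewrite /= in_itv.
apply/seteqP; split=> [x Sx|_ [pr ext [s [_ Ss] <-]] //].
(* The centre has no direction from itself; it is reached at parameter 0 of any extremal pair. *)
have [xz|xz] := eqVneq x z.
  have z0 := boundary_curve0 cE eps_gt0 Bz ext0.
  exists (xi0, y0) => //; exists 0; last by rewrite xz.
  by split; [rewrite /= lexx|rewrite /= z0; rewrite xz in Sx].
have xd : 0 < enorm (x - z) < d.
  rewrite enorm_gt0 subr_eq0 xz /=; case: Sx => _ /closure_eballP/(_ (d / 2)).
  rewrite divr_gt0// => /(_ isT)[u]; rewrite /eball /= => uz ux.
  by have := ler_enorm_dist x u z; rewrite (enorm_distC x u); lra.
have [pr [s [ext s0 xE]]] := rep x Sx.1 xd.
by exists pr => //; exists s => //; split=> //; rewrite -xE.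
Qed.

Lemma boundary_fun_second_order_ae z xi y : extremal_pairs E eps z (xi, y) ->
  @lebesgue_measure R [set s | 0 <= s <= eps / 2 /\ ~ (0 < s < eps / 2 /\
    exists p q, second_order_derivatives (boundary_fun E eps z xi y) s p q)] = 0%E.
Proof.
move=> ext; have [xi1 Ey zy zyxi] := extremal_pairP cE ext.
apply: (@semiconvex_second_order_ae R (eps / 2) (2 / eps)) => s s0.
have [m _ Hm] := boundary_fun_support cE eps_gt0 xi1 Ey zy zyxi (erefl _) s0.
by exists m.
Qed.

End LocalRepresentation.

Unset Implicit Arguments.

Theorem theorem7 (R : realType) (E : set (plane R)) (eps : R)
    (cE : compact E) (eps_gt0 : 0 < eps) :
  hausdorff1 [set x | (boundary (nbhd_eps E eps) `\` inaccessible E eps) x /\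
    ~ (exists (z : plane R) (r : R) (A : plane R * plane R -> set R)
              (xi y : plane R) (s p q kappa : R),
        (boundary (nbhd_eps E eps) `\` inaccessible E eps) z /\
        local_boundary_repr E eps z r A /\
        extremal_pairs E eps z (xi, y) /\
        A (xi, y) s /\ 0 < s < eps / 2 /\
        x = z + s *: xi + boundary_fun E eps z xi y s *: (eps^-1 *: (z - y)) /\
        second_order_derivatives (boundary_fun E eps z xi y) s p q /\
        is_signed_curvature xi (eps^-1 *: (z - y))
          (boundary_curve E eps z xi y) s kappa /\
        kappa = q / (1 + p ^+ 2) `^ (3 / 2))]
  = 0%E.
Proof.
apply: hausdorff1_null; set bad := [set x | _].
(* Localising at points of the exceptional set itself supplies base points [z] outside
   [inaccessible]. *)
apply: content_null_local => z [Xz _]; have Bz := Xz.1.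
have [ext0|noext] := pselect (extremal_pairs E eps z !=set0); last first.
  have [d d0 rep] := boundary_represented cE eps_gt0 Bz.
  exists d => //; apply: content_null_subset (content_null_set1 z).
  move=> x [[[Bx _] _]]; rewrite /eball /= => xz; apply: contrapT => xnz.
  have [|pr [_ [ext _ _]]] := rep x Bx; last by apply: noext; exists pr.
  by rewrite enorm_gt0 subr_eq0 xz andbT; apply/eqP.
have [r r0 loc] := boundary_local_repr cE eps_gt0 Bz ext0.
exists r => //.
(* The endpoints are put into [N], since the conclusion asks for interior parameters; this includes
   the parameter 0 of [z]. *)
pose N (pr : plane R * plane R) := [set s | 0 <= s <= eps / 2 /\ ~ (0 < s < eps / 2 /\
  exists p q, second_order_derivatives (boundary_fun E eps z pr.1 pr.2) s p q)].
apply: (@content_null_subset _ _ (\bigcup_(pr in extremal_pairs E eps z)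
    boundary_curve E eps z pr.1 pr.2 @` N pr)); last first.
  apply: content_null_extremal => // -[xi y] ext.
  have [xi1 Ey zy zyxi] := extremal_pairP cE ext.
  apply: (@content_null_lipschitz _ _ 3) => // [s t [s0 _] [t0 _]|].
    exact: (boundary_curve_lipschitz cE eps_gt0 xi1 Ey zy zyxi (erefl _)).
  exact: boundary_fun_second_order_ae.
move=> x [[[Bx _] nx] xz].
have Sx : (boundary (nbhd_eps E eps) `&` closure (eball z r)) x.
  by split=> //; exact: subset_closure.
have [_ _ repr] := loc; move: Sx; rewrite repr => -[[xi y] ext [s As xE]].
exists (xi, y) => //; exists s => //; split; first by case: As.
move=> [s0 [p [q so]]]; apply: nx.
have [xi1 Ey zy zyxi] := extremal_pairP cE ext.
exists z, r, (curve_domain E eps z r), xi, y, s, p, q, (q / (1 + p ^+ 2) `^ (3 / 2)).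
do 5 split=> //; split; first by rewrite -xE.
split=> //; split=> //; apply: signed_curvature_graph => //.
- exact: (frame_normal eps_gt0 zy (erefl _)).
- exact: (frame_orth zyxi (erefl _)).
Qed.
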